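(* Let $d\geq 2$ be an integer, let $k$ be a field whose characteristic divides neither $d$ nor $d+1$, and let $f:=x^dy+y^dz+z^dw\in S=k[x,y,z,w]$. Let $J:=J_f\subset S$ denote the gradient ideal of $f$. Then: (1) $V(f)\subset\mathbb{P}^3$ has an isolated singularity, its singular locus being supported on the point $(0:0:0:1)$; in particular, $V(f)$ is reduced, irreducible and arithmetically normal. (2) $J$ is an ideal of linear type. (3) Set $J^{\mathrm{sat}}:=J:\mathfrak{m}^{\infty}$, where $\mathfrak{m}=(x,y,z,w)$. Then $J^{\mathrm{sat}}=(J,x^{d-1}z^{d-1})$ and $\mathrm{Soc}(S/J)=J^{\mathrm{sat}}/J$. In particular, the socle degree of $S/J$ is $2d-2$, hence the highest degree in the tail (last free module) of the graded minimal free resolution of $S/J$ is $2d-2+4=2d+2$. (4) The third term in the graded minimal free resolution of $S/J$ over $S$ contains a free summand generated in degree $3d-1$; in particular, the upper degree sequence $\overline{\mathbf{d}}(S/J)$ is decreasing (respectively, strictly decreasing) at the tail provided $d\geq 3$ (respectively, $d>3$).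
   Context: $S$ is standard graded. The gradient (Jacobian) ideal $J_f$ is the ideal generated by the partial derivatives of $f$. An ideal $J$ is of linear type if the natural surjection from its symmetric algebra to its Rees algebra is an isomorphism. $V(f)$ arithmetically normal means $S/(f)$ is normal. $\mathrm{Soc}(S/J)=(J:\mathfrak{m})/J$. The upper degree sequence is $\overline{\mathbf{d}}(S/J)=(\overline{d}_0,\ldots,\overline{d}_4)$ with $\overline{d}_i=\max\{j\mid\mathrm{Tor}_i^S(k,S/J)_j\neq 0\}$ (the resolution of $S/J$ has length $4$); decreasing (resp. strictly decreasing) at the tail means $\overline{d}_3\geq\overline{d}_4$ (resp. $\overline{d}_3>\overline{d}_4$). The third term of the resolution is the free module in homological degree $3$ (with $S$ in homological degree $0$). *)

(* Defs.v *)
From HB Require Import structures.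
From mathcomp Require Import all_boot all_order all_algebra.
From mathcomp Require Import finmap.
From mathcomp Require Import boolp.
From mathcomp.multinomials Require monalg.
From mathcomp.multinomials Require Import mpoly.

Set Implicit Arguments.
Unset Strict Implicit.
Unset Printing Implicit Defensive.

Import Order.TTheory GRing.Theory Num.Theory.
Local Open Scope ring_scope.

Section Ideals.
Context {A : comNzRingType}.
Implicit Types (I J : A -> Prop) (p q : A).

Definition is_ideal I :=
  [/\ I 0, (forall p q, I p -> I q -> I (p + q)) & (forall p q, I q -> I (p * q))].

Definition ideal_gen (G : A -> Prop) : A -> Prop := fun p =>
  exists (n : nat) (c g : 'I_n -> A), (forall i, G (g i)) /\ p = \sum_i c i * g i.

Definition is_prime I :=
  [/\ is_ideal I, ~ I 1 & forall p q, I (p * q) -> I p \/ I q].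

Definition ideal_mul I J : A -> Prop :=
  ideal_gen (fun p => exists a b, [/\ I a, J b & p = a * b]).

Definition ideal_exp I (n : nat) : A -> Prop := iter n (ideal_mul I) (fun=> True).

Definition colon I J : A -> Prop := fun p => forall q, J q -> I (p * q).

Definition saturation I J : A -> Prop := fun p =>
  exists n, colon I (ideal_exp J n) p.

Definition quotient_reduced I := forall p n, I (p ^+ n) -> I p.

(* The quotient A/I is a domain which is integrally closed in its field of
   fractions: if a/b satisfies the monic equation
   (a/b)^n + sum_(i < n) c_i (a/b)^i = 0 over A/I, with b nonzero in A/I,
   then a/b lies in A/I.  The equation is multiplied by b^n. *)
Definition quotient_normal_domain I :=
  is_prime I /\
  forall a b, ~ I b ->
    (exists (n : nat) (c : 'I_n -> A),
       I (a ^+ n + \sum_(i < n) c i * a ^+ i * b ^+ (n - i))) ->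
    exists q, I (a - q * b).

End Ideals.

Section SymmetricAlgebra.
(* This import is kept local: monalg and mpoly overload the same notations. *)
Import monalg.
Context {A : comNzRingType}.
Implicit Types J : A -> Prop.

(* The symmetric algebra of the A-module J is taken to be the polynomial
   algebra A[T_a : a in J] modulo the ideal generated by the forms
   T_(a + b) - T_a - T_b and T_(s a) - s T_a.  The Rees algebra of J is the
   subalgebra A[J t] of A[t], that is, the image of rees_map. *)
Definition ideal_elt J := {a : A | `[< J a >]}.

Definition free_alg J : comNzRingType :=
  malg (cmonom (ideal_elt J)) A.

Definition free_var J (a : ideal_elt J) : free_alg J :=
  mkmalgU (ucm a) 1.

Definition sym_relation J (P : free_alg J) :=
  (exists a b c : ideal_elt J,
     val c = val a + val b /\ P = free_var c - free_var a - free_var b) \/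
  (exists (s : A) (a c : ideal_elt J),
     val c = s * val a /\
     P = free_var c - (mkmalgU mone s : free_alg J) * free_var a).

Definition rees_map J (P : free_alg J) : {poly A} :=
  mmap polyC
    (fun m : cmonom (ideal_elt J) =>
       \prod_(a <- finsupp (cmonom_val m)) (val a *: 'X) ^+ m a) P.

(* The natural surjection Sym(J) -> Rees(J) sends the class of T_a to a t; it is
   an isomorphism when every P with rees_map P = 0 is already zero in Sym(J). *)
Definition linear_type J :=
  forall P : free_alg J, rees_map P = 0 -> ideal_gen (@sym_relation J) P.

End SymmetricAlgebra.

Section Projective.
Context {n : nat} {k : fieldType}.
Local Notation S := {mpoly k[n]}.
Implicit Types (I P Q : S -> Prop) (f p : S).

Definition gradient_ideal f : S -> Prop :=
  ideal_gen (fun p => exists i : 'I_n, p = f^`M(i)).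

Definition irrelevant_ideal : S -> Prop :=
  ideal_gen (fun p => exists i : 'I_n, p = 'X_i).

Definition is_homogeneous_ideal I :=
  is_ideal I /\ forall p e, I p -> I (pihomog (@mdeg n) e p).

Definition proj_point P :=
  [/\ is_prime P, is_homogeneous_ideal P & ~ (forall p, irrelevant_ideal p -> P p)].

Definition proj_zeros I P := proj_point P /\ forall p, I p -> P p.

(* The support of the Jacobian scheme of V(f): the points of Proj S at which f
   and all its partial derivatives vanish. *)
Definition sing_locus f : (S -> Prop) -> Prop :=
  proj_zeros (fun p => p = f \/ gradient_ideal f p).

(* The homogeneous prime ideal of the k-rational point with homogeneous
   coordinates c. *)
Definition rational_point (c : 'I_n -> k) : S -> Prop :=
  ideal_gen (fun p => exists i j : 'I_n, p = c j *: 'X_i - c i *: 'X_j).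

(* P is an isolated point of the singular locus: it is the only singular point
   in some basic open set D(g). *)
Definition isolated_singularity f P :=
  sing_locus f P /\
  exists (e : nat) (g : S), [/\ g \is e.-homog, ~ P g &
    forall Q, sing_locus f Q -> ~ Q g -> forall p, Q p <-> P p].

Definition proj_irreducible I :=
  (exists P, proj_zeros I P) /\
  forall I1 I2, is_homogeneous_ideal I1 -> is_homogeneous_ideal I2 ->
    (forall P, proj_zeros I P -> proj_zeros I1 P \/ proj_zeros I2 P) ->
    (forall P, proj_zeros I P -> proj_zeros I1 P) \/
    (forall P, proj_zeros I P -> proj_zeros I2 P).

(* Degrees are integers: a polynomial which is homogeneous of degree e < 0
   is zero. *)
Definition homogz (e : int) p := forall m, m \in msupp p -> (mdeg m)%:Z = e.

End Projective.

Definition is_greatest (E : int -> Prop) (e : int) :=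
  E e /\ forall e', E e' -> e' <= e.

Section Resolutions.
Context {n : nat} {k : fieldType}.
Local Notation S := {mpoly k[n]}.
Implicit Types (I : S -> Prop).

(* The preimage in S of the submodule Soc(S/I) = (I : m)/I of S/I. *)
Definition socle I : S -> Prop := colon I irrelevant_ideal.

Definition socle_in_degree I (j : int) :=
  exists p : S, [/\ homogz j p, socle I p & ~ I p].

Definition socle_degree I : int -> Prop := is_greatest (socle_in_degree I).

(* F_i is the free module with basis e_a, a : 'I_(rk i), e_a being of degree
   gdeg a; its elements are row vectors and the maps act by right
   multiplication.  The augmentation F_0 -> S/I is given by the representatives
   aug a 0 of the images of the basis elements of F_0. *)
Record graded_free_complex := GradedFreeComplex {
  rk : nat -> nat;
  gdeg : forall i, 'I_(rk i) -> int;
  diff : forall i, 'M[S]_(rk i.+1, rk i);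
  aug : 'cV[S]_(rk 0%N)
}.

Implicit Types (F : graded_free_complex).

Definition is_graded_complex F :=
  (forall a : 'I_(rk F 0), homogz (gdeg a) (aug F a 0)) /\
  (forall i (a : 'I_(rk F i.+1)) (b : 'I_(rk F i)),
     homogz (gdeg a - gdeg b) (diff F i a b)).

Definition graded_free_resolution I F :=
  [/\ is_graded_complex F,
      (exists v : 'rV_(rk F 0), I ((v *m aug F) 0 0 - 1)),
      (forall v : 'rV_(rk F 0),
         I ((v *m aug F) 0 0) <-> exists u, v = u *m diff F 0)
    & (forall i (v : 'rV_(rk F i.+1)),
         v *m diff F i = 0 <-> exists u, v = u *m diff F i.+1)].

Definition minimal_graded_free_resolution I F :=
  graded_free_resolution I F /\
  forall i a b, irrelevant_ideal (diff F i a b).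

(* k (x) F, where the tensor product with k = S/m replaces each matrix entry by
   its constant coefficient. *)
Definition diff_k F i : 'M[k]_(rk F i.+1, rk F i) :=
  map_mx (mcoeff 0%MM) (diff F i).

Definition cycle_k F i : 'rV[k]_(rk F i) -> Prop :=
  match i with
  | 0 => fun=> True
  | i'.+1 => fun v => v *m diff_k F i' = 0
  end.

Definition boundary_k F i (v : 'rV[k]_(rk F i)) := exists u, v = u *m diff_k F i.

(* Tor_i^S(k, S/I)_j is nonzero: computed as the degree j part of H_i(k (x) F)
   for a graded free resolution F of S/I. *)
Definition tor_neq0 I (i : nat) (j : int) :=
  exists F, graded_free_resolution I F /\
    exists v : 'rV[k]_(rk F i),
      [/\ (forall a, v 0 a != 0 -> gdeg a = j), cycle_k v & ~ boundary_k v].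

Definition upper_degree I (i : nat) : int -> Prop := is_greatest (tor_neq0 I i).

Definition upper_degree_sequence I (D : nat -> int) :=
  forall i, (i <= n)%N -> upper_degree I i (D i).

Definition generator_in_degree F i (j : int) := exists a : 'I_(rk F i), gdeg a = j.

Definition last_free_module F i :=
  rk F i <> 0%N /\ forall i', (i < i')%N -> rk F i' = 0%N.

End Resolutions.

(* Main.v *)
(** Write d = m + 2 and let a = x^(d-1) y, b = x^d + d y^(d-1) z,
    c = y^d + d z^(d-1) w, e = z^d be generators of J.

    Since b, c, e is a regular sequence and (b, c, e) : a = (x, y^(d-1) z, c, e)
    is a Hilbert-Burch ideal plus a variable, the mapping cone of multiplication
    by a resolves S/J; cancelling its one unit entry leaves the minimal
    resolution, with Betti numbers 1, 4, 7, 5, 1.  Two graded resolutions are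
    compared through chain maps and a homotopy, so this one computes Tor and the
    generator degrees of every minimal one.

    In the order a, b, c, e the generators form a d-sequence, because
    (a, b, c) : e^2 = (a, b, c) : e = (w, a, b, c); hence J is of linear type.
    The variable w is regular modulo (J, x^(d-1) z^(d-1)), an ideal that the
    irrelevant ideal multiplies into J, which gives saturation and socle.

    For normality, f = g + z^d w is linear in w, so inverting z turns S/(f) into
    k[x, y, z, 1/z], which is integrally closed by a leading monomial argument.
    A fraction p/z integral over S/(f) is then treated at the two minimal primes
    (x, z) and (y, z) of z. *)

(* The mapping cone has ranks 1, 4, 7, 6, 2: the Koszul complex of b, c, e contributes 1, 3, 3, 1,
   and the Hilbert-Burch complex tensored with the Koszul complex of x contributes 1, 4, 5, 2,
   shifted by one step and by degree d. The unit entry sits in degree 3d, between the last Koszul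
   module and the product of x with the second Hilbert-Burch relation. That relation, of degree 2d-1
   before the shift, survives as the generator of degree 3d-1. The product of x with the first
   relation gives the tail, in degree 2d+2.

   Regularity of a variable modulo an ideal is always proved in the same way: set the variable to
   zero, find the syzygies of what remains, and lift them back. When no generator involves the
   variable, there is nothing to lift.

   At the prime (x, z), localization is replaced by multiplication with y^d + z^(d-1) w, which lies
   outside that prime and whose product with z is -x^d y modulo f. *)
Require Import Defs.
From HB Require Import structures.
From mathcomp Require Import all_boot all_order all_algebra.
From mathcomp Require Import finmap boolp ring zify.
From mathcomp.multinomials Require monalg.
From mathcomp.multinomials Require Import mpoly.

Set Implicit Arguments.
Unset Strict Implicit.
Unset Printing Implicit Defensive.

Import Order.TTheory GRing.Theory Num.Theory.
Local Open Scope ring_scope.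

(** * Finitely generated ideals and coprime elements *)

Section IdealSpan.
Context {R : comNzRingType}.
Implicit Types (p q r : R) (gs : seq R).

(** Generators are peeled off one at a time, so membership in an explicit ideal unfolds to a list of
    coefficients and one ring identity. *)
Fixpoint idspan gs p : Prop :=
  if gs is g :: gs' then exists c, idspan gs' (p - c * g) else p = 0.

Lemma idspan0 gs : idspan gs 0.
Proof. by elim: gs => //= g gs IH; exists 0; rewrite mul0r subr0. Qed.

Lemma idspanD gs p q : idspan gs p -> idspan gs q -> idspan gs (p + q).
Proof.
elim: gs p q => [|g gs IH] p q /=; first by move=> -> ->; rewrite addr0.
move=> [c hc] [e he]; exists (c + e).
suff -> : p + q - (c + e) * g = (p - c * g) + (q - e * g) by apply: IH.
by ring.
Qed.

Lemma idspanM gs p q : idspan gs p -> idspan gs (q * p).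
Proof.
elim: gs p q => [|g gs IH] p q /=; first by move=> ->; rewrite mulr0.
move=> [c hc]; exists (q * c).
suff -> : q * p - q * c * g = q * (p - c * g) by apply: IH.
by ring.
Qed.

Lemma idspanN gs p : idspan gs p -> idspan gs (- p).
Proof. by rewrite -mulN1r => /idspanM. Qed.

Lemma idspanB gs p q : idspan gs p -> idspan gs q -> idspan gs (p - q).
Proof. by move=> hp hq; apply: idspanD (idspanN hq). Qed.

Lemma idspan_mem gs g : g \in gs -> idspan gs g.
Proof.
elim: gs => //= h gs IH; rewrite inE => /orP[/eqP ->|/IH hg].
  by exists 1; rewrite mul1r subrr; apply: idspan0.
by exists 0; rewrite mul0r subr0.
Qed.

Lemma idspan_sub gs hs p :
  (forall g, g \in gs -> idspan hs g) -> idspan gs p -> idspan hs p.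
Proof.
elim: gs p => [|g gs IH] p h /=; first by move=> ->; apply: idspan0.
move=> [c hc]; rewrite -(subrK (c * g) p); apply: idspanD.
  by apply: IH hc => g' hg'; apply: h; rewrite inE hg' orbT.
by apply: idspanM; apply: h; rewrite inE eqxx.
Qed.

Lemma idspan_cat gs hs p :
  idspan (gs ++ hs) p <-> exists q, idspan gs q /\ idspan hs (p - q).
Proof.
elim: gs p => [|g gs IH] p /=.
  split=> [h|[q [-> ]]]; last by rewrite subr0.
  by exists 0; rewrite subr0.
split=> [[c /IH[q [hq hp]]]|[q [[c hc] hp]]].
  exists (q + c * g); split; first by exists c; rewrite addrK.
  by rewrite opprD addrA addrAC.
exists c; apply/IH; exists (q - c * g); split=> //.
by rewrite opprB addrA subrK.
Qed.

Lemma idspanP (I : R -> Prop) gs :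
  is_ideal I -> (forall g, g \in gs -> I g) -> forall p, idspan gs p -> I p.
Proof.
move=> [I0 ID IM]; elim: gs => [|g gs IH] h p /=; first by move=> ->.
move=> [c hc]; rewrite -(subrK (c * g) p); apply: ID.
  by apply: IH hc => g' hg'; apply: h; rewrite inE hg' orbT.
by apply: IM; apply: h; rewrite inE eqxx.
Qed.

Lemma idspan_ideal gs : is_ideal (idspan gs).
Proof. by split=> [|p q|p q]; [apply: idspan0|apply: idspanD|apply: idspanM]. Qed.

Lemma ideal_gen_ideal (G : R -> Prop) : is_ideal (ideal_gen G).
Proof.
split.
- exists 0%N, (fun=> 0), (fun=> 0); split; first by case.
  by rewrite big_ord0.
- move=> p q [n [c [g [hg ->]]]] [n' [c' [g' [hg' ->]]]].
  exists (n + n')%N.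
  exists (fun i => match split i with inl j => c j | inr j => c' j end).
  exists (fun i => match split i with inl j => g j | inr j => g' j end); split.
    by move=> i; case: (split i).
  rewrite big_split_ord /=; congr (_ + _); apply: eq_bigr => i _.
    by rewrite (unsplitK (inl i)).
  by rewrite (unsplitK (inr i)).
- move=> p q [n [c [g [hg ->]]]]; exists n, (fun i => p * c i), g; split=> //.
  by rewrite mulr_sumr; apply: eq_bigr => i _; rewrite mulrA.
Qed.

Lemma ideal_gen_mem (G : R -> Prop) p : G p -> ideal_gen G p.
Proof.
by move=> hp; exists 1%N, (fun=> 1), (fun=> p); split; rewrite // big_ord1 mul1r.
Qed.

Lemma ideal_gen_min (G I : R -> Prop) :
  is_ideal I -> (forall g, G g -> I g) -> forall p, ideal_gen G p -> I p.
Proof.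
move=> [I0 ID IM] h p [n [c [g [hg ->]]]].
by apply: (big_ind I I0 ID) => i _; apply: IM; apply: h.
Qed.

Lemma ideal_preim_mul (I : R -> Prop) t : is_ideal I -> is_ideal (fun p => I (t * p)).
Proof.
move=> [I0 ID IM]; split=> [|p q hp hq|p q hq]; first by rewrite mulr0.
  by rewrite mulrDr; apply: ID.
by rewrite mulrCA; apply: IM.
Qed.

Lemma ideal_congX (I : R -> Prop) p q e :
  is_ideal I -> I (p - q) -> I (p ^+ e - q ^+ e).
Proof. by move=> [_ _ IM] h; rewrite subrXX mulrC; apply: IM. Qed.

Lemma ideal_congM (I : R -> Prop) p q p' q' :
  is_ideal I -> I (p - p') -> I (q - q') -> I (p * q - p' * q').
Proof.
move=> [_ ID IM] hp hq.
have -> : p * q - p' * q' = q * (p - p') + p' * (q - q') by ring.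
by apply: ID; apply: IM.
Qed.

(* The monic equation of the fraction p/q, with the denominator q^e cleared. *)
Definition homog_eqn e (c : 'I_e -> R) p q :=
  p ^+ e + \sum_(i < e) c i * p ^+ i * q ^+ (e - i).

Lemma homog_eqn_cong (I : R -> Prop) e (c : 'I_e -> R) p q p' q' :
  is_ideal I -> I (p - p') -> I (q - q') ->
  I (homog_eqn c p q - homog_eqn c p' q').
Proof.
move=> hI hp hq; have [I0 ID IM] := hI; rewrite /homog_eqn opprD addrACA.
apply: (ID); first exact: ideal_congX.
rewrite -sumrB; apply: (big_ind I I0 ID) => i _.
rewrite -!mulrA -mulrBr; apply: IM.
by apply: ideal_congM => //; apply: ideal_congX.
Qed.

Lemma homog_eqn_scale e (c : 'I_e -> R) p q t :
  homog_eqn c (t * p) (t * q) = t ^+ e * homog_eqn c p q.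
Proof.
rewrite /homog_eqn mulrDr exprMn mulr_sumr; congr (_ + _).
apply: eq_bigr => i _; rewrite !exprMn.
have -> : t ^+ e = t ^+ (e - i) * t ^+ i by rewrite -exprD subnK // ltnW.
by ring.
Qed.

End IdealSpan.

Section Coprime.
Context {R : idomainType}.
Implicit Types (p q u v : R).

(** This is regularity of [u] modulo [v]; the condition becomes symmetric once [v] is nonzero. *)
Definition cop u v := forall p q, u * p = v * q -> exists r, p = v * r.

Lemma cop_sym u v : v != 0 -> cop u v -> cop v u.
Proof.
move=> v0 h p q E; have [r hr] := h q p (esym E).
by exists r; apply: (mulfI v0); rewrite E hr; ring.
Qed.

Lemma cop1 v : cop 1 v.
Proof. by move=> p q; rewrite mul1r => ->; exists q. Qed.

Lemma cop_mull u u' v : cop u v -> cop u' v -> cop (u * u') v.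
Proof. by move=> h h' p q; rewrite -mulrA => /h[r /h']. Qed.

Lemma cop_expl u v n : cop u v -> cop (u ^+ n) v.
Proof.
by move=> h; elim: n => [|n IH]; [apply: cop1|rewrite exprS; apply: cop_mull].
Qed.

Lemma cop_mulr u v v' : cop u v -> cop u v' -> cop u (v * v').
Proof.
move=> h h' p q E; have [r hr] := h p (v' * q) (etrans E (esym (mulrA _ _ _))).
case: (eqVneq v 0) => [v0|v0]; first by exists 0; rewrite hr v0 !mul0r.
have [r' hr'] : exists r', r = v' * r'.
  by apply: (h' r q); apply: (mulfI v0); rewrite [RHS]mulrA -E hr; ring.
by exists r'; rewrite hr hr' mulrA.
Qed.

Lemma cop_expr u v n : cop u v -> cop u (v ^+ n).
Proof.
move=> h; elim: n => [|n IH]; last by rewrite exprS; apply: cop_mulr.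
by move=> p q _; exists p; rewrite expr0 mul1r.
Qed.

End Coprime.

Section Kill.
Context {n : nat} {k : fieldType}.
Local Notation S := {mpoly k[n]}.
Implicit Types (p q : S) (i j : 'I_n).

Lemma mpoly_gen_ind (P : S -> Prop) :
  (forall c, P c%:MP) -> (forall i, P 'X_i) ->
  (forall p q, P p -> P q -> P (p + q)) ->
  (forall p q, P p -> P q -> P (p * q)) -> forall p, P p.
Proof.
move=> hC hX hD hM; elim/mpolyind=> [|c m p _ _ hp]; first by rewrite -mpolyC0.
apply: (hD) => //; rewrite -mul_mpolyC; apply: (hM) => //.
have h1 : P 1 by rewrite -mpolyC1.
rewrite mpolyXE_id; apply: (big_ind P h1 hM) => i _.
by elim: (m i) => [|e IH]; rewrite ?expr0 // exprS; apply: hM.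
Qed.

Definition subst (t : 'I_n -> S) : S -> S := comp_mpoly [tuple t i | i < n].

HB.instance Definition _ t := GRing.RMorphism.copy (subst t)
  (comp_mpoly [tuple t i | i < n]).

Lemma substX t i : subst t 'X_i = t i.
Proof. by rewrite /subst comp_mpolyXU -tnth_nth tnth_mktuple. Qed.

Lemma substC t c : subst t c%:MP = c%:MP.
Proof. exact: comp_mpolyC. Qed.

Definition kill i : S -> S := subst (fun j => if i == j then 0 else 'X_j).

HB.instance Definition _ i := GRing.RMorphism.copy (kill i)
  (subst (fun j => if i == j then 0 else 'X_j)).

Lemma killC i c : kill i c%:MP = c%:MP.
Proof. exact: substC. Qed.

Lemma kill0 i : kill i 0 = 0. Proof. exact: rmorph0. Qed.
Lemma killD i : {morph kill i : p q / p + q}. Proof. exact: rmorphD. Qed.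
Lemma killN i : {morph kill i : p / - p}. Proof. exact: rmorphN. Qed.
Lemma killM i : {morph kill i : p q / p * q}. Proof. exact: rmorphM. Qed.
Lemma killXn i e : {morph kill i : p / p ^+ e}. Proof. exact: rmorphXn. Qed.

Lemma killX i j : kill i 'X_j = if i == j then 0 else 'X_j.
Proof. exact: substX. Qed.

Lemma killK i p : kill i (kill i p) = kill i p.
Proof.
elim/mpoly_gen_ind: p => [c|j|p q hp hq|p q hp hq].
- by rewrite !killC.
- by rewrite killX; case: ifP => h; rewrite ?rmorph0 // killX h.
- by rewrite !killD hp hq.
- by rewrite !killM hp hq.
Qed.

Lemma kill_decomp i p : exists q, p = kill i p + 'X_i * q.
Proof.
elim/mpoly_gen_ind: p => [c|j|p q [p' hp] [q' hq]|p q [p' hp] [q' hq]].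
- by exists 0; rewrite killC mulr0 addr0.
- rewrite killX; case: eqP => [->|_]; last by exists 0; rewrite mulr0 addr0.
  by exists 1; rewrite mulr1 add0r.
- by exists (p' + q'); rewrite killD {1}hp {1}hq; ring.
- exists (p' * kill i q + kill i p * q' + 'X_i * p' * q').
  by rewrite killM {1}hp {1}hq; ring.
Qed.

Lemma X_neq0 i : 'X_i != 0 :> S.
Proof. by rewrite -msize_poly_eq0 msizeX. Qed.

End Kill.

(* All that the syzygy computations use of k[x, y, z, w]: four elements x_i and
   endomorphisms x_i := 0. *)
Record setting (R : idomainType) := Setting {
  var : 'I_4 -> R;
  ev0 : 'I_4 -> {rmorphism R -> R};
  ev0X : forall i j, ev0 i (var j) = if i == j then 0 else var j;
  ev0_decomp : forall i p, exists q, p = ev0 i p + var i * q;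
  var_neq0 : forall i, var i != 0
}.

Definition mpoly_setting (k : fieldType) : setting {mpoly k[4]} :=
  @Setting _ (fun i => 'X_i) (fun i => kill i : {rmorphism _ -> _})
    killX kill_decomp X_neq0.

Section Setting.
Context {R : idomainType} (V : setting R).
Implicit Types (p q : R) (i j : 'I_4).

Lemma ev0_eq0 i p : ev0 V i p = 0 -> exists q, p = var V i * q.
Proof. by case: (ev0_decomp V i p) => q {2}-> ->; exists q; rewrite add0r. Qed.

Lemma ev0_eq0_two i j p : ev0 V i (ev0 V j p) = 0 ->
  exists p1 p2, p = p1 * var V i + p2 * var V j.
Proof.
move=> /ev0_eq0[q hq]; have [r hr] := ev0_decomp V j p.
by exists q, r; rewrite {1}hr hq; ring.
Qed.

Lemma cop_var i u : ev0 V i u != 0 -> cop u (var V i).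
Proof.
move=> hu p q E; apply: ev0_eq0; apply: (mulfI hu).
by rewrite -rmorphM E rmorphM ev0X eqxx mul0r mulr0.
Qed.

(** The generators do not involve [var V i], so membership can be tested separately on the part of
    [p] free of that variable and on the remaining multiple of it. *)
Lemma idspan_ev0_decomp i gs p :
  (forall g, g \in gs -> ev0 V i g = g) -> idspan gs p ->
  idspan gs (ev0 V i p) /\ exists q, p = ev0 V i p + var V i * q /\ idspan gs q.
Proof.
elim: gs p => [|g gs IH] p h /=.
  by move=> ->; rewrite rmorph0; split=> //; exists 0; rewrite mulr0 addr0.
have h' g' : g' \in gs -> ev0 V i g' = g'.
  by move=> hg'; apply: h; rewrite inE hg' orbT.
move=> [c /(IH _ h')].
rewrite rmorphB rmorphM (h g) ?inE ?eqxx // => -[h1 [q [h2 h3]]].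
split; first by exists (ev0 V i c).
have [c' hc'] := ev0_decomp V i c.
exists (q + c' * g); split; last by exists c'; rewrite addrK.
rewrite -{1}(subrK (c * g) p) h2 {2}hc'; ring.
Qed.

Lemma idspan_ev0_nzd i gs p :
  (forall g, g \in gs -> ev0 V i g = g) -> idspan gs (var V i * p) -> idspan gs p.
Proof.
move=> h /(idspan_ev0_decomp h)[_ [q [E hq]]].
suff -> : p = q by [].
by apply: (mulfI (var_neq0 V i)); rewrite E rmorphM ev0X eqxx mul0r add0r.
Qed.

Lemma idspan_ev0_nzdX i gs e p :
  (forall g, g \in gs -> ev0 V i g = g) -> idspan gs (var V i ^+ e * p) -> idspan gs p.
Proof.
move=> h; elim: e => [|e IH]; first by rewrite mul1r.
by rewrite exprS -mulrA => /(idspan_ev0_nzd h).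
Qed.

End Setting.

(** * Syzygies and colon ideals of the partial derivatives *)

Section SmallMatrices.
Context {R : comNzRingType}.
Implicit Types (s t : seq R) (l : seq (seq R)).

(** Literal lists make matrix products compute: with [comb], each entry becomes an explicit
    polynomial that [ring] can treat. *)
Definition mx_of m n l : 'M[R]_(m, n) := \matrix_(i, j) nth 0 (nth [::] l i) j.

Fixpoint comb s l (j : nat) : R :=
  match s, l with
  | a :: s', r :: l' => a * nth 0 r j + comb s' l' j
  | _, _ => 0
  end.

Lemma mulmx_ofE m n p l1 l2 (i : 'I_m) (j : 'I_p) :
  size (nth [::] l1 i) = n -> size l2 = n ->
  (mx_of m n l1 *m mx_of n p l2) i j = comb (nth [::] l1 i) l2 j.
Proof.
rewrite mxE; under eq_bigr => u _ do rewrite !mxE.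
move: (nth _ _ _) => s; elim: s n l2 => [|a s IH] [|n] [|r l2] //=.
  by rewrite big_ord0.
by move=> [hs] [hl]; rewrite big_ord_recl /= -(IH n).
Qed.

Lemma mulrow_of n p s l : size s = n -> size l = n ->
  mx_of 1 n [:: s] *m mx_of n p l = mx_of 1 p [:: [seq comb s l j | j <- iota 0 p]].
Proof.
move=> hs hl; apply/matrixP => i j; rewrite (ord1 i) mulmx_ofE // mxE /=.
by rewrite (nth_map 0%N) ?size_iota // nth_iota.
Qed.

Lemma mulrow_eq0 n p s l : size s = n -> size l = n ->
  mx_of 1 n [:: s] *m mx_of n p l = 0 -> forall j, (j < p)%N -> comb s l j = 0.
Proof.
move=> hs hl h j hj; have := congr1 (fun A : 'M__ => A 0 (Ordinal hj)) h.
by rewrite mulmx_ofE // mxE.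
Qed.

Lemma row_mx_of n (v : 'rV[R]_n) : exists s, size s = n /\ v = mx_of 1 n [:: s].
Proof.
exists [seq v 0 j | j <- enum 'I_n]; split; first by rewrite size_map size_enum_ord.
apply/rowP => j; rewrite mxE /= (nth_map j) ?size_enum_ord //.
by rewrite nth_ord_enum.
Qed.

Lemma exact_of_rows m n p (A : 'M[R]_(m, n)) (B : 'M[R]_(n, p)) :
  A *m B = 0 ->
  (forall s, size s = n -> mx_of 1 n [:: s] *m B = 0 ->
     exists u : 'rV_m, mx_of 1 n [:: s] = u *m A) ->
  forall v : 'rV_n, v *m B = 0 <-> exists u, v = u *m A.
Proof.
move=> AB h v; split=> [|[u ->]]; last by rewrite -mulmxA AB mulmx0.
by have [s [hs ->]] := row_mx_of v; apply: h.
Qed.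

End SmallMatrices.

Lemma ord4P (i : 'I_4) :
  [\/ i = @Ordinal 4 0 isT, i = @Ordinal 4 1 isT, i = @Ordinal 4 2 isT
    | i = @Ordinal 4 3 isT].
Proof.
by case: i => -[|[|[|[|//]]]] hi; [constructor 1|constructor 2|constructor 3
  |constructor 4]; apply: val_inj.
Qed.

Section JacobianIdeal.
Context {R : idomainType} (V : setting R).
Local Notation ix := (@Ordinal 4 0 isT).
Local Notation iy := (@Ordinal 4 1 isT).
Local Notation iz := (@Ordinal 4 2 isT).
Local Notation iw := (@Ordinal 4 3 isT).
Local Notation x := (var V ix).
Local Notation y := (var V iy).
Local Notation z := (var V iz).
Local Notation w := (var V iw).
Implicit Types (p q r s : R).
(* Here d = m + 2 and [del] is the image of d; the partial derivatives of f are
   [del * ga], [gb], [gc] and [ge]. *)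
Variables (m : nat) (del : R).
Hypothesis del_unit : del \is a GRing.unit.
Hypothesis ev0_del : forall i, ev0 V i del = del.
Local Notation X1 := (x ^+ m.+1).
Local Notation Y1 := (y ^+ m.+1).
Local Notation Z1 := (z ^+ m.+1).
Local Notation ga := (X1 * y).
Local Notation gb := (x * X1 + del * Y1 * z).
Local Notation gc := (y * Y1 + del * Z1 * w).
Local Notation ge := (z * Z1).

Let del_neq0 : del != 0.
Proof. by apply: contraTneq del_unit => ->; rewrite unitr0. Qed.

Let V_neq0 := (var_neq0 V ix, var_neq0 V iy, var_neq0 V iz, var_neq0 V iw, del_neq0).

Let zero_X (e : nat) : 0 ^+ e.+1 = 0 :> R. Proof. by rewrite exprS mul0r. Qed.

Let ev0V :
  ((ev0 V ix x = 0) * (ev0 V ix y = y) * (ev0 V ix z = z) * (ev0 V ix w = w)) *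
  ((ev0 V iy x = x) * (ev0 V iy y = 0) * (ev0 V iy z = z) * (ev0 V iy w = w)) *
  ((ev0 V iz x = x) * (ev0 V iz y = y) * (ev0 V iz z = 0) * (ev0 V iz w = w)) *
  ((ev0 V iw x = x) * (ev0 V iw y = y) * (ev0 V iw z = z) * (ev0 V iw w = 0)).
Proof. by rewrite !ev0X. Qed.

Let ev0S := (rmorph0, rmorph1, rmorphD, rmorphB, rmorphN, rmorphXn, rmorphM,
  ev0V, ev0_del, zero_X, @mul0r R, @mulr0 R, @add0r R, @addr0 R, @oppr0 R, @subr0 R).

(** * Colon ideals of the complete intersection of [gb], [gc], [ge] *)

Lemma gc_neq0 : gc != 0.
Proof.
have : ev0 V iw gc != 0.
  by rewrite !ev0S mulf_neq0 ?expf_neq0 ?V_neq0.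
by apply: contraNneq => ->; rewrite rmorph0.
Qed.

Lemma cop_cz : cop gc z.
Proof.
apply: cop_var; rewrite !ev0S.
by rewrite mulf_neq0 ?expf_neq0 ?V_neq0.
Qed.

Lemma cop_ce : cop gc ge.
Proof. by apply: cop_mulr; [|apply: cop_expr]; apply: cop_cz. Qed.

Lemma cop_yz : cop y z.
Proof. by apply: cop_var; rewrite ev0V V_neq0. Qed.

Lemma cop_yZ : cop y Z1.
Proof. exact/cop_expr/cop_yz. Qed.

Lemma cop_YZ : cop Y1 Z1.
Proof. exact/cop_expl/cop_yZ. Qed.

Lemma kx_ce g : g \in [:: gc; ge] -> ev0 V ix g = g.
Proof. by rewrite !inE => /orP[] /eqP ->; rewrite !ev0S. Qed.

(** Modulo [gc] and [ge] the product of [gb] with its conjugate [x * X1 - del * Y1 * z] is the pure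
    power [(x * X1) ^+ 2], because [Y1 ^+ 2 * z ^+ 2] lies in the ideal. Powers of [x] cancel, as
    [gc] and [ge] are free of [x]. *)
Lemma idspan_ce_b s : idspan [:: gc; ge] (gb * s) -> idspan [:: gc; ge] s.
Proof.
move=> h; apply: (idspan_ev0_nzd kx_ce); apply: (idspan_ev0_nzdX (e := m.+1) kx_ce).
apply: (idspan_ev0_nzd kx_ce); apply: (idspan_ev0_nzdX (e := m.+1) kx_ce).
have -> : X1 * (x * (X1 * (x * s))) = (x * X1 - del * Y1 * z) * (gb * s)
    + (del ^+ 2 * y ^+ m * z ^+ 2 * s) * gc
    - (del ^+ 3 * y ^+ m * z * w * s) * ge.
  by rewrite [Y1]exprS; ring.
apply: idspanB; last by apply/idspanM/idspan_mem; rewrite !inE eqxx orbT.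
by apply: idspanD; [apply: idspanM|apply/idspanM/idspan_mem; rewrite !inE eqxx].
Qed.

(** The new generator comes from [y * (z * Y1) = z * gc - del * w * ge]; the proof shows that no
    other one is needed. *)
Lemma colon_ce_y s :
  idspan [:: gc; ge] (y * s) -> idspan [:: z * Y1; gc; ge] s.
Proof.
move=> [g [e /eqP]]; rewrite subr_eq0 subr_eq => /eqP E.
have Z0 : Z1 != 0 by rewrite expf_neq0 ?V_neq0.
have [t ht] : exists t, s - g * Y1 = Z1 * t.
  apply: (cop_yZ (q := del * g * w + e * z)).
  by rewrite mulrBr E; ring.
have ht2 : del * g * w + e * z = y * t.
  by apply: (mulfI Z0); rewrite mulrCA -ht mulrBr E; ring.
(* At [y = z = 0] the equation [ht2] reduces to [del * g * w = 0], which forces [g] into the ideal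
   of [y] and [z]. *)
have [g1 [g2 hg]] : exists g1 g2, g = g1 * y + g2 * z.
  apply: ev0_eq0_two; have /eqP := congr1 (fun p => ev0 V iy (ev0 V iz p)) ht2.
  rewrite !ev0S !mulf_eq0.
  by rewrite (negPf del_neq0) (negPf (var_neq0 V _)) orbF => /eqP.
have [t2 ht3] : exists t2, t - del * w * g1 = z * t2.
  apply: (cop_yz (q := e + del * w * g2)).
  by rewrite mulrBr -ht2 hg; ring.
have he : e + del * w * g2 = y * t2.
  apply: (mulfI (var_neq0 V iz)); rewrite mulrCA -ht3 mulrBr -ht2 hg; ring.
exists g2, g1, t2.
have -> : s = g * Y1 + Z1 * (del * w * g1 + z * t2).
  by rewrite -ht3 addrC -(subrK (g * Y1) s) ht; ring.
by rewrite hg; ring.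
Qed.

(** Cancelling the power of [x] that [ga] and [gb] share turns [ga * s = v * gb] into
    [s * y = v * x] modulo [gc], [ge]. Setting [x = 0] then leaves the colon ideal by [y]. *)
Lemma colon_bce_a s :
  idspan [:: gb; gc; ge] (ga * s) -> idspan [:: x; Y1 * z; gc; ge] s.
Proof.
move=> [v hv].
have h1 : idspan [:: gc; ge] (s * y - v * x).
  apply: (idspan_ev0_nzd kx_ce); apply: (idspan_ev0_nzdX (e := m.+1) kx_ce).
  apply: (idspan_ev0_nzdX (e := m.+1) kx_ce).
  have -> : X1 * (X1 * (x * (s * y - v * x))) =
    (x * X1 - del * Y1 * z) * (ga * s - v * gb)
    + (del * X1 * s * z - del ^+ 2 * v * y ^+ m * z ^+ 2) * gc
    + (del ^+ 3 * v * y ^+ m * z * w - del ^+ 2 * X1 * s * w) * ge.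
    by rewrite [Y1]exprS; ring.
  apply: idspanD; last by apply/idspanM/idspan_mem; rewrite !inE eqxx orbT.
  by apply: idspanD; [apply: idspanM|apply/idspanM/idspan_mem; rewrite !inE eqxx].
have [h2 _] := idspan_ev0_decomp kx_ce h1.
rewrite !ev0S [ev0 V ix s * y]mulrC in h2.
have [s' hs] := ev0_decomp V ix s.
suff h : idspan [:: Y1 * z; gc; ge] (s - s' * x) by exists s'.
have -> : s - s' * x = ev0 V ix s by rewrite {1}hs; ring.
by rewrite [Y1 * z]mulrC; apply: colon_ce_y.
Qed.

(* Hilbert-Burch: the ideal (Y1 z, gc, ge) is determinantal. *)
Lemma syz_HB t2 t3 t4 : t2 * (Y1 * z) + t3 * gc + t4 * ge = 0 ->
  exists l u, [/\ t2 = l * y + u * Z1, t3 = - l * z & t4 = l * (del * w) - u * Y1].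
Proof.
move=> E.
have Z0 : Z1 != 0 by rewrite expf_neq0 ?V_neq0.
have [v hv] : exists v, t2 * z + t3 * y = Z1 * v.
  apply: (cop_YZ (q := - (del * w * t3 + z * t4))).
  by apply/eqP; rewrite -subr_eq0 -{}E; apply/eqP; ring.
have hv2 : - (del * w * t3 + z * t4) = Y1 * v.
  apply: (mulfI Z0); rewrite mulrCA -hv.
  by apply/eqP; rewrite -subr_eq0 -oppr_eq0 -{}E; apply/eqP; ring.
have [l hl] : exists l, t3 = z * l.
  apply: (cop_yz (q := z ^+ m * v - t2)).
  have -> : y * t3 = Z1 * v - t2 * z by rewrite -hv; ring.
  by rewrite exprS; ring.
have hl2 : z ^+ m * v - t2 = y * l.
  apply: (mulfI (var_neq0 V iz)); have -> : z * (z ^+ m * v - t2) = Z1 * v - z * t2 by rewrite exprS; ring.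
  by rewrite -hv hl; ring.
have [u hu] : exists u, v = z * u.
  apply: (cop_expl (n := m.+1) cop_yz (q := - (del * w * l + t4))).
  by rewrite -hv2 hl; ring.
exists (- l), u; split.
- rewrite -[t2]opprK -[- t2](addrK (z ^+ m * v)) [- t2 + _]addrC hl2 hu.
  by rewrite [Z1]exprS; ring.
- by rewrite hl; ring.
apply: (mulfI (var_neq0 V iz)).
have -> : z * t4 = - (Y1 * v) - del * w * t3 by rewrite -hv2; ring.
by rewrite hu hl; ring.
Qed.
(* The rows of [rows1] are the lifts of x, Y1 z, gc, ge to syzygies of
   (ga, gb, gc, ge), followed by the Koszul syzygies of (gb, gc, ge).  The rows
   of [rows2] come from the two Hilbert-Burch relations and from the Koszul
   relations with x. *)
Let rows1 : seq (seq R) :=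
  [:: [:: x; - y; del * z; - (del ^+ 2 * w)];
      [:: Y1 * z; 0; - (X1 * z); del * X1 * w];
      [:: gc; 0; - ga; 0];
      [:: ge; 0; 0; - ga];
      [:: 0; gc; - gb; 0];
      [:: 0; ge; 0; - gb];
      [:: 0; 0; ge; - gc] ].

Let rows2 : seq (seq R) :=
  [:: [:: 0; y; - z; del * w; 0; 0; 0];
      [:: 0; Z1; 0; - Y1; 0; 0; X1];
      [:: Y1 * z; - x; 0; 0; z; - (del * w); 0];
      [:: gc; 0; - x; 0; y; 0; - (del ^+ 2 * w)];
      [:: ge; 0; 0; - x; 0; y; - (del * z)] ].

(** * The reduced mapping cone and its exactness *)

Definition res1 : 'M[R]_(4, 1) := mx_of 4 1 [:: [:: ga]; [:: gb]; [:: gc]; [:: ge]].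
Definition res2 : 'M[R]_(7, 4) := mx_of 7 4 rows1.
Definition res3 : 'M[R]_(5, 7) := mx_of 5 7 rows2.
(** The Koszul relation between [x] and the first Hilbert-Burch row. The analogous relation with the
    second row is the one cancelled by the unit entry. *)
Definition res4 : 'M[R]_(1, 5) := mx_of 1 5 [:: [:: x; 0; y; - z; del * w]].

Lemma res21 : res2 *m res1 = 0.
Proof.
apply/matrixP => -[i hi] [[|//] hj].
have hs : size (nth [::] rows1 i) = 4%N by case: i hi => [|[|[|[|[|[|[|i]]]]]]].
rewrite mulmx_ofE // mxE {hs}.
by case: i hi => [|[|[|[|[|[|[|i]]]]]]] //= _; ring.
Qed.

Lemma res32 : res3 *m res2 = 0.
Proof.
apply/matrixP => -[i hi] [j hj].
have hs : size (nth [::] rows2 i) = 7%N by case: i hi => [|[|[|[|[|i]]]]].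
rewrite mulmx_ofE // mxE {hs}.
by case: i hi => [|[|[|[|[|i]]]]] //= _; case: j hj => [|[|[|[|j]]]] //= _; ring.
Qed.

Lemma res43 : res4 *m res3 = 0.
Proof.
apply/matrixP => -[[|//] hi] [j hj].
rewrite mulmx_ofE // mxE.
by case: j hj => [|[|[|[|[|[|[|j]]]]]]] //= _; ring.
Qed.

Lemma ge_neq0 : ge != 0.
Proof. by rewrite mulf_neq0 ?expf_neq0 ?V_neq0. Qed.

(** The coefficient of [ga] lies in the colon ideal, whose generators lift to the first four rows.
    Subtracting these lifts leaves a syzygy of the regular sequence [gb], [gc], [ge], hence a
    combination of the three Koszul rows. *)
Lemma res1_exact (h : 'rV[R]_4) : h *m res1 = 0 <-> exists u, h = u *m res2.
Proof.
apply: exact_of_rows; first exact: res21.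
move=> [|sa [|sb [|sc [|se [|]]]]] // _ /mulrow_eq0 => /(_ erefl erefl 0%N isT) /= E.
have [t1 [t2 [t3 [t4 ht]]]] : idspan [:: x; Y1 * z; gc; ge] sa.
  apply: colon_bce_a; exists (- sb), (- sc), (- se).
  by rewrite /= -[RHS]E; ring.
have {}ht : sa = t1 * x + t2 * (Y1 * z) + t3 * gc + t4 * ge.
  by apply/eqP; rewrite -subr_eq0 -ht; apply/eqP; ring.
have [u1 [u2 hu]] : idspan [:: gc; ge] (sb + t1 * y).
  apply: idspan_ce_b.
  exists (- (sc - t1 * del * z + t2 * X1 * z + t3 * ga)).
  exists (- (se + t1 * del ^+ 2 * w - t2 * del * X1 * w + t4 * ga)).
  by rewrite /= -[RHS]E ht; ring.
have {}hu : sb = - t1 * y + u1 * gc + u2 * ge.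
  by apply/eqP; rewrite -subr_eq0 -hu; apply/eqP; ring.
have [u3 hu3] : exists u3,
    sc - t1 * del * z + t2 * X1 * z + t3 * ga + u1 * gb = ge * u3.
  apply: (cop_ce (q := - (se + t1 * del ^+ 2 * w - t2 * del * X1 * w + t4 * ga + u2 * gb))).
  by apply/eqP; rewrite -subr_eq0 -[X in _ == X]E ht hu; apply/eqP; ring.
have hse : se = - t1 * del ^+ 2 * w + t2 * del * X1 * w - t4 * ga - u2 * gb - u3 * gc.
  apply: (mulfI ge_neq0).
  apply/eqP; rewrite -subr_eq0 -[X in _ == X]E ht hu.
  have -> : sc = ge * u3 + t1 * del * z - t2 * X1 * z - t3 * ga - u1 * gb.
    by rewrite -hu3; ring.
  by apply/eqP; ring.
have hsc : sc = ge * u3 + t1 * del * z - t2 * X1 * z - t3 * ga - u1 * gb.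
  by rewrite -hu3; ring.
exists (mx_of 1 7 [:: [:: t1; t2; t3; t4; u1; u2; u3]]); rewrite mulrow_of //=.
congr (mx_of _ _ [:: [:: _; _; _; _]]); rewrite ?ht ?hu ?hse ?hsc; ring.
Qed.

Lemma res2_exact (h : 'rV[R]_7) : h *m res2 = 0 <-> exists u, h = u *m res3.
Proof.
apply: exact_of_rows; first exact: res32.
move=> [|t1 [|t2 [|t3 [|t4 [|u1 [|u2 [|u3 [|]]]]]]]] // _ /mulrow_eq0.
move=> /(_ erefl erefl) E.
have := E 0%N isT; have := E 1%N isT; have := E 2%N isT; have := E 3%N isT.
rewrite /= => {E} E3 E2 E1 E0.
have [t2' h2] := ev0_decomp V ix t2.
have [t3' h3] := ev0_decomp V ix t3.
have [t4' h4] := ev0_decomp V ix t4.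
(* At [x = 0] the first column is a syzygy of [Y1 * z], [gc], [ge]. *)
have [l [v [hl2 hl3 hl4]]] : exists l u,
    [/\ ev0 V ix t2 = l * y + u * Z1, ev0 V ix t3 = - l * z
      & ev0 V ix t4 = l * (del * w) - u * Y1].
  apply: syz_HB; have := congr1 (ev0 V ix) E0; rewrite !ev0S => <-; ring.
have {}h2 : t2 = l * y + v * Z1 + x * t2' by rewrite h2 hl2.
have {}h3 : t3 = - l * z + x * t3' by rewrite h3 hl3.
have {}h4 : t4 = l * (del * w) - v * Y1 + x * t4' by rewrite h4 hl4.
have {hl2 hl3 hl4} h1 : t1 = - (t2' * (Y1 * z) + t3' * gc + t4' * ge).
  apply: (mulfI (var_neq0 V ix)); apply/eqP; rewrite -subr_eq0 -[X in _ == X]E0 h2 h3 h4.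
  by apply/eqP; ring.
have [v' hv'] : exists v', u1 + t2' * z + t3' * y = ge * v'.
  apply: (cop_ce (q := - (u2 - t2' * (del * w) + t4' * y))).
  by apply/eqP; rewrite -subr_eq0 -[X in _ == X]E1 h1 h2 h3 h4; apply/eqP; ring.
have hu1 : u1 = ge * v' - t2' * z - t3' * y by rewrite -hv'; ring.
have hu2 : u2 = - gc * v' + t2' * (del * w) - t4' * y.
  apply: (mulfI ge_neq0); apply/eqP; rewrite -subr_eq0 -[X in _ == X]E1 h1 h2 h3 h4 hu1.
  by apply/eqP; ring.
have hu3 : u3 = gb * v' + t3' * (del ^+ 2 * w) + t4' * (del * z) + v * X1.
  apply: (mulfI ge_neq0); apply/eqP; rewrite -subr_eq0 -[X in _ == X]E2 h1 h2 h3 h4 hu1.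
  by apply/eqP; ring.
(* The multiple [v'] belongs to the top Koszul relation with entries [ge], [- gc], [gb] in the last
   three places. It was cancelled from the resolution because it equals [x] times the second row,
   plus [Z1] times the third, minus [Y1] times the fifth. *)
exists (mx_of 1 5 [:: [:: l; v + x * v'; - t2' + Z1 * v'; - t3'; - t4' - Y1 * v']]).
rewrite mulrow_of //=.
congr (mx_of _ _ [:: [:: _; _; _; _; _; _; _]]);
  rewrite ?h1 ?h2 ?h3 ?h4 ?hu1 ?hu2 ?hu3; ring.
Qed.

Lemma res3_exact (h : 'rV[R]_5) : h *m res3 = 0 <-> exists u, h = u *m res4.
Proof.
apply: exact_of_rows; first exact: res43.
move=> [|t1 [|t2 [|t3 [|t4 [|t5 [|]]]]]] // _ /mulrow_eq0.
move=> /(_ erefl erefl) E.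
(* These columns suffice: 2, 4 and 5 have two nonzero entries each and fix [t1], [t4], [t3], [t5] up
   to a common factor, and column 1 then kills [t2]. *)
have := E 1%N isT; have := E 2%N isT; have := E 4%N isT; have := E 5%N isT.
rewrite /= => {E} E5 E4 E2 E1.
have [v hv] : exists v, t1 = x * v.
  have czx : cop z x by apply: cop_var; rewrite ev0V V_neq0.
  apply: (czx _ (- t4)); apply/eqP; rewrite -subr_eq0 -oppr_eq0 -[X in _ == X]E2.
  by apply/eqP; ring.
have h4 : t4 = - z * v.
  apply: (mulfI (var_neq0 V ix)); apply/eqP; rewrite -subr_eq0 -oppr_eq0 -[X in _ == X]E2 hv.
  by apply/eqP; ring.
have h3 : t3 = y * v.
  apply: (mulfI (var_neq0 V iz)); apply/eqP; rewrite -subr_eq0 -[X in _ == X]E4 h4.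
  by apply/eqP; ring.
have h5 : t5 = del * w * v.
  apply: (mulfI (var_neq0 V iy)); apply/eqP; rewrite -subr_eq0 -[X in _ == X]E5 h3.
  by apply/eqP; ring.
have h2 : t2 = 0.
  apply: (mulfI (expf_neq0 m.+1 (var_neq0 V iz))); rewrite mulr0 -[RHS]E1 hv h3.
  by ring.
exists (mx_of 1 1 [:: [:: v]]); rewrite mulrow_of //=.
congr (mx_of _ _ [:: [:: _; _; _; _; _]]); rewrite ?hv ?h2 ?h3 ?h4 ?h5; ring.
Qed.

Lemma res4_inj (h : 'rV[R]_1) : h *m res4 = 0 -> h = 0.
Proof.
move=> E; apply/rowP => j; rewrite ord1 [RHS]mxE; apply: (mulIf (var_neq0 V ix)).
have := congr1 (fun A : 'rV_5 => A 0 0) E.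
by rewrite !mxE big_ord1 mxE /= mul0r => ->.
Qed.

(** * The d-sequence property of [ga], [gb], [gc], [ge] *)

Lemma ga_neq0 : ga != 0.
Proof. by rewrite mulf_neq0 ?expf_neq0 ?V_neq0. Qed.

Lemma cop_ba : cop gb ga.
Proof.
apply: cop_mulr; first apply: cop_expr; apply: cop_var; rewrite !ev0S.
  by rewrite !mulf_neq0 ?expf_neq0 ?V_neq0.
by rewrite mulf_neq0 ?expf_neq0 ?V_neq0.
Qed.

Lemma cop_cx : cop gc x.
Proof. by apply: cop_var; rewrite !ev0S gc_neq0. Qed.

Lemma cop_cy : cop gc y.
Proof. by apply: cop_var; rewrite !ev0S !mulf_neq0 ?expf_neq0 ?V_neq0. Qed.

Lemma cop_xy : cop x y.
Proof. by apply: cop_var; rewrite !ev0S V_neq0. Qed.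

Definition nzd_mod gs b := forall s, idspan gs (b * s) -> idspan gs s.

(** Since [v] is regular modulo [g], the quotient by [u * v] and [g] is an extension of the quotient
    by [v] and [g] by a copy of the quotient by [u] and [g]. Regularity on both ends gives it in the
    middle. *)
Lemma nzd_mod_mul b u v g :
  cop v g -> nzd_mod [:: u; g] b -> nzd_mod [:: v; g] b ->
  nzd_mod [:: u * v; g] b.
Proof.
move=> hvg hu hv s [r1 [r2 E]].
have [t [t' /eqP]] : idspan [:: v; g] s.
  by apply: hv; exists (r1 * u), r2; rewrite /= -[RHS]E; ring.
rewrite -addrA -opprD subr_eq0 => /eqP hs.
have [r hr] : exists r, b * t - r1 * u = g * r.
  apply: (hvg _ (r2 - b * t')); apply/eqP; rewrite -subr_eq0 -[X in _ == X]E hs.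
  by apply/eqP; ring.
have [q [q' /eqP]] : idspan [:: u; g] t.
  apply: hu; exists r1, r.
  by rewrite /= -addrA -opprD [r * g]mulrC -hr; ring.
rewrite -addrA -opprD subr_eq0 => /eqP ht.
by exists q, (q' * v + t'); rewrite hs ht; ring.
Qed.

(** Modulo [y], [gb] and [gc] become the coprime monomials [x * X1] and [del * Z1 * w]. *)
Lemma nzd_b_yc : nzd_mod [:: y; gc] gb.
Proof.
move=> s [a [b E]].
have := congr1 (ev0 V iy) E; rewrite !ev0S => /eqP.
rewrite subr_eq0 => /eqP Ey.
have [r hr] : exists r, ev0 V iy b = x * X1 * r.
  have h : cop (del * Z1 * w) x.
    by apply: cop_var; rewrite !ev0S !mulf_neq0 ?expf_neq0 ?V_neq0.
  have {}h := cop_mulr h (cop_expr (n := m.+1) h).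
  by apply: (h _ (ev0 V iy s)); rewrite mulrC -Ey.
have hs : ev0 V iy s = del * Z1 * w * r.
  apply: (mulfI (x := x * X1)); first by rewrite mulf_neq0 ?expf_neq0 ?V_neq0.
  by rewrite Ey hr; ring.
have [s' hs'] := ev0_decomp V iy s.
by exists (s' - r * Y1), r; rewrite hs' hs; ring.
Qed.

(** Modulo [x], [gb] becomes [del * Y1 * z], and [gc] is coprime to [y] and to [z]. *)
Lemma nzd_b_xc : nzd_mod [:: x; gc] gb.
Proof.
move=> s [a [b E]].
have := congr1 (ev0 V ix) E; rewrite !ev0S => /eqP.
rewrite subr_eq0 => /eqP Ex.
have [r hr] : exists r, ev0 V ix b = Y1 * z * r.
  have h := cop_mulr (cop_expr (n := m.+1) cop_cy) cop_cz.
  by apply: (h _ (del * ev0 V ix s)); rewrite [LHS]mulrC -Ex; ring.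
have hs : ev0 V ix s = gc * (del^-1 * r).
  rewrite mulrCA; apply: (mulrI del_unit); rewrite mulVKr //.
  apply: (mulfI (x := Y1 * z)); first by rewrite mulf_neq0 ?expf_neq0 ?V_neq0.
  have -> : Y1 * z * (del * ev0 V ix s) = del * Y1 * z * ev0 V ix s by ring.
  by rewrite Ex hr; ring.
have [s' hs'] := ev0_decomp V ix s.
by exists s', (del^-1 * r); rewrite hs' hs; ring.
Qed.

Lemma nzd_b_ac : nzd_mod [:: ga; gc] gb.
Proof.
apply: (nzd_mod_mul _ _ nzd_b_yc); first exact: cop_sym (var_neq0 V iy) cop_cy.
suff h e : nzd_mod [:: x ^+ e; gc] gb by exact: h.
elim: e => [|e IH].
  by move=> s _; exists s, 0; rewrite expr0; ring.
rewrite exprSr; apply: (nzd_mod_mul _ IH nzd_b_xc).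
exact: cop_sym (var_neq0 V ix) cop_cx.
Qed.

(** Splitting [ga] into powers of [x] and [y] shows that [ga], [gc], [gb] is a regular sequence;
    here its last two terms are exchanged. *)
Lemma nzd_c_ab : nzd_mod [:: ga; gb] gc.
Proof.
move=> s [a [b E]].
have [b1 [b2 /eqP]] : idspan [:: ga; gc] b.
  by apply: nzd_b_ac; exists (- a), s; rewrite /= -[RHS]oppr0 -[X in _ = - X]E; ring.
rewrite -addrA -opprD subr_eq0 => /eqP hb.
have h : cop gc ga by apply: cop_mulr cop_cy; apply: cop_expr cop_cx.
have [r hr] : exists r, s - b2 * gb = ga * r.
  apply: (h _ (a + b1 * gb)); apply/eqP; rewrite -subr_eq0 -[X in _ == X]E hb.
  by apply/eqP; ring.
by exists r, b2; rewrite -[s](subrK (b2 * gb)) hr; ring.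
Qed.

(** At [z = 0] the generators become monomials, and their syzygies lift. The only one that changes
    is the relation between [ga] and [gb], which becomes [y * gb - x * ga = del * z * (y * Y1)] and
    accounts for the term [del * u] in the witness. *)
Lemma nzd_z_aby : nzd_mod [:: ga; gb; y * Y1] z.
Proof.
move=> s [a [b [c E]]].
have := congr1 (ev0 V iz) E; rewrite !ev0S => Ez.
have [a' ha] := ev0_decomp V iz a.
have [b' hb] := ev0_decomp V iz b.
have [c' hc] := ev0_decomp V iz c.
have [t ht] : exists t, ev0 V iz c = X1 * t.
  have h : cop (y * Y1) X1.
    apply: cop_expr; apply: cop_var.
    by rewrite !ev0S mulf_neq0 ?expf_neq0 ?V_neq0.
  apply: (h _ (- (ev0 V iz a * y + ev0 V iz b * x))).
  by apply/eqP; rewrite -subr_eq0 -oppr_eq0 -[X in _ == X]Ez; apply/eqP; ring.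
have X0 : X1 != 0 by rewrite expf_neq0 ?V_neq0.
have E1 : x * ev0 V iz b = y * (- (ev0 V iz a + t * Y1)).
  apply: (mulfI X0); apply/eqP; rewrite -subr_eq0 -oppr_eq0 -[X in _ == X]Ez ht.
  by apply/eqP; ring.
have [u hu] := cop_xy E1.
have hu2 : ev0 V iz a = - (t * Y1) - x * u.
  apply: (mulfI (var_neq0 V iy)).
  have -> : y * ev0 V iz a = - (x * ev0 V iz b) - y * (t * Y1) by rewrite E1; ring.
  by rewrite hu; ring.
exists a', b', (c' + del * u).
apply: (mulfI (var_neq0 V iz)); rewrite mulr0 -[RHS]E {1}ha {1}hb {1}hc.
rewrite hu2 hu ht; ring.
Qed.

Lemma nzd_z_waby : nzd_mod [:: w; ga; gb; y * Y1] z.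
Proof.
move=> s [a E].
have hE : forall g, g \in [:: ga; gb; y * Y1] -> ev0 V iw g = g.
  by move=> g; rewrite !inE => /or3P[] /eqP ->; rewrite !ev0S.
have [] := idspan_ev0_decomp hE E.
rewrite !ev0S => /nzd_z_aby h _.
have [s' hs] := ev0_decomp V iw s.
suff : idspan [:: ga; gb; y * Y1] (s - s' * w) by exists s'.
by have -> : s - s' * w = ev0 V iw s by rewrite {1}hs; ring.
Qed.

Lemma nzd_mod_exp gs b e : nzd_mod gs b -> nzd_mod gs (b ^+ e).
Proof.
move=> h; elim: e => [|e IH] s; first by rewrite mul1r.
by rewrite exprS -mulrA => /h /IH.
Qed.

(** This is the first row of [res2], solved for its last term. *)
Lemma we_abc : w * ge = del^-1 * del^-1 * (x * ga - y * gb + del * z * gc).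
Proof.
have -> : x * ga - y * gb + del * z * gc = del * (del * (w * ge)) by ring.
by rewrite -mulrA !mulKr.
Qed.

(* gc and y Y1 agree modulo w, and w * ge lies in (ga, gb, gc). *)
Lemma colon_abc_e s :
  idspan [:: ga; gb; gc] (ge * (ge * s)) -> idspan [:: ga; gb; gc] (ge * s).
Proof.
move=> [a [b [c E]]].
have [e1 [e2 [e3 [e4 /eqP]]]] : idspan [:: w; ga; gb; y * Y1] s.
  apply: (nzd_mod_exp (e := (m.+2 + m.+2)%N) nzd_z_waby).
  exists (c * (del * Z1)), a, b, c.
  by rewrite /= -[RHS]E exprD [z ^+ m.+2]exprS; ring.
rewrite -!addrA -!opprD subr_eq0 => /eqP ->.
set u := e1 - e4 * del * Z1.
have -> : ge * (e1 * w + (e2 * ga + (e3 * gb + e4 * (y * Y1)))) =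
  u * (w * ge) + (ge * e2) * ga + (ge * e3) * gb + (ge * e4) * gc.
  by rewrite /u; ring.
rewrite we_abc; set v := del^-1 * del^-1.
by exists (u * v * x + ge * e2), (ge * e3 - u * v * y), (ge * e4 + u * v * del * z); ring.
Qed.

(** * Saturation and socle *)

Let gu := X1 * Z1.

(** Only [gc] involves [w]. Lifting a syzygy from [w = 0] therefore costs [c0 * del * Z1 * w], and
    it suffices that [c0] lies in the ideal of [X1] and [z], since [X1 * Z1 = gu] and
    [z * Z1 = ge]. *)
Lemma nzd_w_sat : nzd_mod [:: ga; gb; gc; ge; gu] w.
Proof.
move=> s [a [b [c [e [u E]]]]].
have := congr1 (ev0 V iw) E; rewrite !ev0S => Ew.
have [a' ha] := ev0_decomp V iw a.
have [b' hb] := ev0_decomp V iw b.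
have [c' hc] := ev0_decomp V iw c.
have [e' he] := ev0_decomp V iw e.
have [u' hu] := ev0_decomp V iw u.
move: Ew ha hb hc he hu; move: (ev0 V iw a) (ev0 V iw b) (ev0 V iw c).
move: (ev0 V iw e) (ev0 V iw u) => e0 u0 a0 b0 c0 Ew ha hb hc he hu.
(* In [Ew] the term [b0 * x ^+ m.+2] is the only one outside the ideal of [y] and [Z1], and [x] is
   regular modulo that ideal. *)
have [b1 [b2 /eqP]] : idspan [:: y; Z1] b0.
  have h g : g \in [:: y; Z1] -> ev0 V ix g = g.
    by rewrite !inE => /orP[] /eqP ->; rewrite !ev0S.
  apply: (idspan_ev0_nzdX (e := m.+2) h).
  exists (- (a0 * X1 + b0 * del * y ^+ m * z + c0 * Y1)).
  exists (- (e0 * z + u0 * X1)).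
  by rewrite /= -[RHS]oppr0 -[X in _ = - X]Ew [x ^+ m.+2]exprS /gu [Y1]exprS; ring.
rewrite -addrA -opprD subr_eq0 => /eqP hb0.
have [g1 [g2 /eqP]] : idspan [:: X1; ge] (c0 + b1 * del * z).
  have h g : g \in [:: X1; ge] -> ev0 V iy g = g.
    by rewrite !inE => /orP[] /eqP ->; rewrite !ev0S.
  apply: (idspan_ev0_nzdX (e := m.+2) h).
  exists (- ((a0 + b1 * x) * y + (u0 + b2 * x) * Z1)).
  exists (- (e0 + b2 * del * Y1)).
  by rewrite /= -[RHS]oppr0 -[X in _ = - X]Ew [y ^+ m.+2]exprS /gu hb0; ring.
rewrite -addrA -opprD subr_eq0 => /eqP hc0.
(* The corrections to [e'] and [u'] absorb [del * Z1 * w * c0] with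
   [c0 = g1 * X1 + g2 * ge - b1 * del * z]. *)
exists a', b', c', (e' + del * g2 * Z1 - b1 * del ^+ 2), (u' + del * g1).
apply: (mulfI (var_neq0 V iw)); rewrite mulr0.
have -> : w * (s - a' * ga - b' * gb - c' * gc
      - (e' + del * g2 * Z1 - b1 * del ^+ 2) * ge - (u' + del * g1) * gu)
    = (w * s - a * ga - b * gb - c * gc - e * ge - u * gu)
    - (0 - a0 * ga - b0 * (x * X1 + del * Y1 * z) - c0 * (y * Y1) - e0 * ge - u0 * gu)
    + del * Z1 * w * ((c0 + b1 * del * z) - (g1 * X1 + g2 * ge)).
  by rewrite ha hb hc he hu /gu; ring.
rewrite E hc0 subrr mulr0 addr0 sub0r; apply/eqP; rewrite oppr_eq0; apply/eqP.
by rewrite -[RHS]Ew /gu; ring.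
Qed.

Lemma socle_gu i : idspan [:: ga; gb; gc; ge] (gu * var V i).
Proof.
case: (ord4P i) => ->.
- exists 0, Z1, 0, (- del * Y1); rewrite /gu; ring.
- exists Z1, 0, 0, 0; rewrite /gu; ring.
- exists 0, 0, 0, X1; rewrite /gu; ring.
have -> : gu * w = del^-1 * (X1 * gc - Y1 * ga).
  by have -> : X1 * gc - Y1 * ga = del * (gu * w); [rewrite /gu; ring|rewrite mulKr].
exists (- (del^-1 * Y1)), 0, (del^-1 * X1), 0; ring.
Qed.

(** At [y = w = 0] only the monomials [x ^+ m.+2] and [z ^+ m.+2] remain as generators, and neither
    divides [gu]. *)
Lemma gu_notin : ~ idspan [:: ga; gb; gc; ge] gu.
Proof.
move=> [a [b [c [e E]]]].
have := congr1 (fun p => ev0 V iw (ev0 V iy p)) E; rewrite /= !ev0S.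
move: (ev0 V iw (ev0 V iy b)) (ev0 V iw (ev0 V iy e)) => {a b c e E} b e E.
have cXz : cop X1 z by apply/cop_expl/cop_var; rewrite ev0V V_neq0.
have cZx : cop Z1 x by apply/cop_expl/cop_var; rewrite ev0V V_neq0.
have Z0 : Z1 != 0 by rewrite expf_neq0 ?V_neq0.
have [t ht] : exists t, Z1 - b * x = Z1 * t.
  apply: (cop_expr (n := m.+1) cXz (q := e * z)).
  by apply/eqP; rewrite -subr_eq0 -[X in _ == X]E; apply/eqP; ring.
have [t' ht'] : exists t', t = z * t'.
  apply: (cXz _ e); apply: (mulfI Z0).
  rewrite mulrCA -ht; apply/eqP; rewrite -subr_eq0 -[X in _ == X]E.
  by apply/eqP; ring.
have [r hr] : exists r, 1 - t = x * r.
  by apply: (cZx _ b); rewrite mulrBr -ht; ring.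
have := congr1 (fun p => ev0 V ix (ev0 V iz p)) hr; rewrite /= ht' !ev0S => /eqP.
by rewrite oner_eq0.
Qed.

(** * Integral fractions with denominator [z] *)

Local Notation gf := (x ^+ m.+2 * y + y ^+ m.+2 * z + z ^+ m.+2 * w).
Let expSS (v : R) : v ^+ m.+2 = v * v ^+ m.+1. Proof. exact: exprS. Qed.

Lemma homog_eqn_ev0 i j e (c : 'I_e -> R) p q :
  ev0 V i (ev0 V j q) = 0 ->
  ev0 V i (ev0 V j (homog_eqn c p q)) = ev0 V i (ev0 V j p) ^+ e.
Proof.
move=> hq; rewrite /homog_eqn !rmorphD !rmorphXn /= !rmorph_sum /=.
rewrite big1 ?addr0 // => u _; rewrite !rmorphM !rmorphXn /= hq.
by rewrite expr0n subn_eq0 leqNgt ltn_ord mulr0.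
Qed.

Section IntegralFraction.
Hypothesis gf_prime :
  forall p q, idspan [:: gf] (p * q) -> idspan [:: gf] p \/ idspan [:: gf] q.
Variables (e : nat) (c : 'I_e -> R) (p : R).
Hypothesis integral_p : idspan [:: gf] (homog_eqn c p z).

(** Both [gf] and [z] vanish at [y = z = 0], so the integral equation reduces to [p ^+ e = 0]
    there. *)
Lemma integral_ev0_yz : ev0 V iy (ev0 V iz p) = 0.
Proof.
have [h /(congr1 (fun q => ev0 V iy (ev0 V iz q)))] := integral_p.
rewrite /= rmorphB rmorphB homog_eqn_ev0 ?ev0S // => /eqP.
by rewrite expf_eq0 => /andP[_ /eqP].
Qed.

(* p / z is integral at the prime (x, z), where z = - x^d y / (y^d + z^(d-1) w)
   has order d = m + 2, so p vanishes to order d as well. *)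
Lemma integral_order_x a : (a <= m.+2)%N ->
  exists p' p'', idspan [:: gf] (p - (x ^+ a * p' + z * p'')).
Proof.
elim: a => [|a IH] ha.
  exists p, 0; rewrite expr0 mul1r mulr0 addr0 subrr; exact: idspan0.
have [p' [p'' hp]] := IH (ltnW ha).
(* Modulo [gf], [eta * z] equals [- x ^+ m.+2 * y]. Multiplying numerator and denominator of [p / z]
   by [eta] and then removing [x ^+ a] yields [p1 / q1]. *)
pose eta := y * Y1 + Z1 * w.
pose p1 := p' * eta - x ^+ (m.+2 - a) * y * p''.
pose q1 := - (x ^+ (m.+2 - a) * y).
have Ex : x ^+ m.+2 = x ^+ a * x ^+ (m.+2 - a) by rewrite -exprD subnKC // ltnW.
have h1 : idspan [:: gf] (eta * p - x ^+ a * p1).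
  have [r hr] := hp; exists (eta * r + p'').
  rewrite /= -[RHS](mulr0 eta) -[X in _ = eta * X]hr /p1 /eta Ex !expSS; ring.
have h2 : idspan [:: gf] (eta * z - x ^+ a * q1).
  by exists 1; rewrite /= /q1 /eta Ex !expSS; ring.
have h3 : idspan [:: gf] ((x ^+ a) ^+ e * homog_eqn c p1 q1).
  rewrite -homog_eqn_scale.
  rewrite -[homog_eqn _ _ _](subKr (homog_eqn c (eta * p) (eta * z))).
  apply: idspanB; first by rewrite homog_eqn_scale; apply: idspanM.
  exact: homog_eqn_cong (idspan_ideal _) h1 h2.
have [hx|h4] := gf_prime h3.
  have [r /(congr1 (fun q => ev0 V iy (ev0 V iz q)))] := hx.
  rewrite /= -exprM !ev0S => /eqP.
  by rewrite (negPf (expf_neq0 _ (var_neq0 V _))).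
(* As [a < m.+2], [x] still divides [q1]. At [x = z = 0] the equation becomes a power of
   [p' * (y * Y1)], so [p'] vanishes there and one more factor [x] comes out. *)
have ev_p' : ev0 V ix (ev0 V iz p') = 0.
  have [r /(congr1 (fun q => ev0 V ix (ev0 V iz q)))] := h4.
  have x0 : x ^+ (m.+2 - a) = x * x ^+ (m.+1 - a) by rewrite -exprS subSn.
  rewrite /= rmorphB rmorphB homog_eqn_ev0; last by rewrite /q1 x0 !ev0S.
  rewrite /p1 /eta x0 !ev0S => /eqP; rewrite expf_eq0 => /andP[_].
  by rewrite !mulf_eq0 !expf_eq0 !(negPf (var_neq0 V _)) ?orbF ?andbF ?orbF => /eqP.
have [u [v huv]] := ev0_eq0_two ev_p'.
exists u, (x ^+ a * v + p''); have [r hr] := hp; exists r.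
by rewrite /= -[RHS]hr huv [x ^+ a.+1]exprS; ring.
Qed.

(** With [p = x ^+ m.+2 * p' + z * p''], vanishing at [y = z = 0] puts [p'] in the ideal of [y] and
    [z], and [x ^+ m.+2 * y] is a multiple of [z] modulo [gf]. *)
Lemma integral_div_z : exists q, idspan [:: gf] (p - q * z).
Proof.
have [p' [p'' [r hr]]] := integral_order_x (leqnn _).
have : ev0 V iy (ev0 V iz p') = 0.
  have := congr1 (fun q => ev0 V iy (ev0 V iz q)) hr.
  rewrite !ev0S integral_ev0_yz sub0r => /eqP; rewrite oppr_eq0 mulf_eq0.
  by rewrite expf_eq0 (negPf (var_neq0 V _)) andbF => /eqP.
move=> /ev0_eq0_two[a [b hab]].
exists (p'' + x ^+ m.+2 * b - (y * Y1 + Z1 * w) * a), (r + a).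
rewrite /= -[RHS]hr hab !expSS; ring.
Qed.

End IntegralFraction.

(** The first three generators form a regular sequence. For the last one, [p] in the full ideal may
    be replaced by a multiple [t * ge], which brings the case down to [colon_abc_e]. *)
Lemma d_sequence_abce i p (gs := [:: ga; gb; gc; ge]) : (i < size gs)%N ->
  idspan (take i gs) (nth 0 gs i * p) -> idspan gs p -> idspan (take i gs) p.
Proof.
case: i => [|[|[|[|//]]]] _ /=.
- by move=> /eqP; rewrite mulf_eq0 (negPf ga_neq0) => /eqP.
- move=> [q /eqP]; rewrite subr_eq0 => /eqP E _.
  have [r hr] := cop_ba (etrans E (mulrC _ _)).
  by exists r; rewrite hr mulrC subrr.
- by move=> h _; apply: nzd_c_ab.
move=> h [a [b [c [t /eqP]]]]; rewrite subr_eq0 => /eqP E.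
have hp : idspan [:: ga; gb; gc] (p - t * ge) by exists a, b, c; rewrite -E /=; ring.
rewrite -[p](subrK (t * ge)); apply: (@idspanD _ [:: ga; gb; gc]) => //.
rewrite [t * ge]mulrC; apply: colon_abc_e.
have -> : ge * (ge * t) = ge * p - ge * (p - t * ge) by ring.
by apply: (@idspanB _ [:: ga; gb; gc]) => //; apply: idspanM.
Qed.

End JacobianIdeal.

(** * Integral closedness of polynomial rings *)

Section AlmostIntegral.
Context {R : comNzRingType}.
Implicit Types (a b g t : R).

(** Read [g] as a common denominator for all powers of [a / b]; by the binomial formula it also
    serves for [a / b - t]. *)
Lemma almost_integral_shift a b g t :
  (forall e, exists q, g * a ^+ e = q * b ^+ e) ->
  forall e, exists q, g * (a - t * b) ^+ e = q * b ^+ e.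
Proof.
move=> h e.
rewrite exprBn mulr_sumr.
apply: (big_ind (fun p => exists q, p = q * b ^+ e)).
- by exists 0; rewrite mul0r.
- by move=> p1 p2 [q1 ->] [q2 ->]; exists (q1 + q2); rewrite mulrDl.
move=> i _; have [q hq] := h (e - i)%N.
exists ((-1) ^+ i * q * t ^+ i *+ 'C(e, i)).
have -> : b ^+ e = b ^+ (e - i) * b ^+ i by rewrite -exprD subnK // -ltnS.
rewrite mulrnAr mulrnAl; congr (_ *+ _).
have -> : g * ((-1) ^+ i * a ^+ (e - i) * (t * b) ^+ i)
  = (-1) ^+ i * (g * a ^+ (e - i)) * (t * b) ^+ i by ring.
by rewrite hq exprMn; ring.
Qed.

(** The equation expresses powers of [a / b] from the exponent [e] on through lower ones, so
    [b ^+ e] clears all denominators. *)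
Lemma integral_almost a b e (c : 'I_e -> R) :
  a ^+ e + \sum_(i < e) c i * a ^+ i * b ^+ (e - i) = 0 ->
  forall j, exists q, b ^+ e * a ^+ j = q * b ^+ j.
Proof.
move=> E; elim/ltn_ind => j IH; case: (leqP j e) => [le_je|lt_ej].
  exists (b ^+ (e - j) * a ^+ j).
  by rewrite -{1}(subnK le_je) exprD; ring.
have -> : a ^+ j = a ^+ (j - e) * a ^+ e by rewrite -exprD subnK // ltnW.
move/eqP: E; rewrite addr_eq0 => /eqP ->.
rewrite !mulrN !mulr_sumr -sumrN.
apply: (big_ind (fun p => exists q, p = q * b ^+ j)).
- by exists 0; rewrite mul0r.
- by move=> p1 p2 [q1 ->] [q2 ->]; exists (q1 + q2); rewrite mulrDl.
move=> i _; have [|q hq] := IH (j - e + i)%N; first by have := ltn_ord i; lia.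
exists (- (c i * q)).
have -> : b ^+ j = b ^+ (j - e + i) * b ^+ (e - i).
  by rewrite -exprD; congr (_ ^+ _); have := ltn_ord i; lia.
have -> : b ^+ e * (a ^+ (j - e) * (c i * a ^+ i * b ^+ (e - i))) =
    c i * (b ^+ e * a ^+ (j - e + i)) * b ^+ (e - i) by rewrite exprD; ring.
by rewrite hq; ring.
Qed.

End AlmostIntegral.

Section Normality.
Context {n : nat} {k : fieldType}.
Local Notation S := {mpoly k[n]}.

(* Leading monomials show that the polynomial ring is completely integrally
   closed: [g a^e] divisible by [b^e] for all [e] forces [mlead b <= mlead a],
   and subtracting a multiple of [b] from [a] preserves the hypothesis. *)
Lemma mpoly_cic (a b g : S) : g != 0 -> b != 0 ->
  (forall e, exists q, g * a ^+ e = q * b ^+ e) -> exists q, a = q * b.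
Proof.
move=> g0 b0; move: {2}(mlead a) (erefl (mlead a)) => M.
elim/(well_founded_induction (@ltom_wf n)): M a => M IH a hM h.
case: (eqVneq a 0) => [->|a0]; first by exists 0; rewrite mul0r.
have le_ba : (mlead b <= mlead a)%MM.
  apply/mnm_lepP => i; rewrite leqNgt; apply/negP => hlt.
  (* If the exponent of [b] exceeds that of [a] in variable [i], the gap grows at least like [e];
     this [e] makes it larger than what [g] can compensate. *)
  pose e := (mlead g i).+1; have [q hq] := h e.
  have q0 : q != 0.
    by apply: contraTneq (mulf_neq0 g0 (expf_neq0 e a0)) => q0;
      rewrite negbK hq q0 mul0r.
  have /mnmP/(_ i) := congr1 (@mlead _ _) hq.
  rewrite (mleadM g0 (expf_neq0 e a0)) (mleadM q0 (expf_neq0 e b0)).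
  rewrite (mleadX e a0) (mleadX e b0) !mnmDE !mulmnE => hE.
  have aux (G A B Q : nat) : (A < B)%N -> (G + A * G.+1 != Q + B * G.+1)%N.
    move=> h1; have := leq_mul h1 (leqnn G.+1); rewrite mulSn; lia.
  by have /negP := aux (mlead g i) _ _ (mlead q i) hlt; apply; apply/eqP.
pose t : S := (mleadc a / mleadc b) *: 'X_[mlead a - mlead b].
have lb0 : mleadc b != 0 by rewrite mleadc_eq0.
have la0 : mleadc a != 0 by rewrite mleadc_eq0.
have t0 : t != 0.
  by rewrite scaler_eq0 negb_or mulf_neq0 ?invr_eq0 //= -msize_poly_eq0 msizeX.
have htb : mlead (t * b) = mlead a.
  rewrite mleadM // mleadZ ?mulf_neq0 ?invr_eq0 // mleadXm.
  by rewrite submK.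
have hc : mleadc (t * b) = mleadc a.
  rewrite mleadM // mleadcM /t mleadZ ?mulf_neq0 ?invr_eq0 // mleadXm.
  by rewrite mcoeffZ mcoeffX eqxx mulr1 divfK.
have h' := almost_integral_shift t h.
case: (eqVneq (a - t * b) 0) => [/eqP|d0].
  by rewrite subr_eq0 => /eqP; exists t.
have [q hq] : exists q, a - t * b = q * b.
  apply: (IH (mlead (a - t * b))) h' => //.
  rewrite -hM lt_neqAle; apply/andP; split; last first.
    by rewrite (le_trans (mleadB_le _ _)) // htb joinxx.
  apply: contraNneq d0 => E; rewrite -mleadc_eq0 E mcoeffB -{2}htb hc subrr //.
by exists (q + t); rewrite mulrDl -hq subrK.
Qed.

Lemma mpoly_normal (a b : S) e (c : 'I_e -> S) : b != 0 ->
  a ^+ e + \sum_(i < e) c i * a ^+ i * b ^+ (e - i) = 0 -> exists q, a = q * b.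
Proof.
move=> b0 /integral_almost h.
exact: mpoly_cic (expf_neq0 e b0) b0 h.
Qed.

End Normality.

(** * Graded resolutions *)

Section HomogeneousIdeals.
Context {n : nat} {k : fieldType}.
Local Notation S := {mpoly k[n]}.
Implicit Types (p q : S) (I : S -> Prop).
Local Notation pih := (pihomog (@mdeg n)).

Lemma pihomogM d q : q \is d.-homog -> forall e p,
  pih e (p * q) = if (d <= e)%N then pih (e - d) p * q else 0.
Proof.
move=> hq e p; have hi i : pih i p * q \is (i + d).-homog.
  by apply: dhomogM hq; apply: pihomogP.
rewrite {1}(pihomog_partitionE (leqnn (msize p))) mulr_suml raddf_sum /=.
have term i : pih e (pih i p * q) = if (i + d)%N == e then pih i p * q else 0.
  case: eqP => [<-|/eqP ne]; first by rewrite pihomog_dE.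
  by rewrite (pihomog_ne0 ne).
under eq_bigr => i _ do rewrite term.
case: leqP => [le_de|lt_ed]; last first.
  by rewrite big1 // => i _; case: eqP => // E; move: lt_ed; rewrite -E; lia.
case: (ltnP (e - d) (msize p)) => [lt|ge].
  rewrite (bigD1 (Ordinal lt)) //= subnK // eqxx big1 ?addr0 // => i ne.
  case: eqP => // E; case/eqP: ne; apply: val_inj => /=; lia.
rewrite big1 => [|i _]; last first.
  by case: eqP => // E; have := ltn_ord i; lia.
rewrite pihomogE big_seq_cond big1 ?mul0r // => u /andP[/msize_mdeg_lt hu /eqP E].
by move: hu; rewrite E; lia.
Qed.

Lemma homog_ideal_gen (G : S -> Prop) :
  (forall g, G g -> exists d, g \is d.-homog) -> is_homogeneous_ideal (ideal_gen G).
Proof.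
move=> hG; split; first exact: ideal_gen_ideal.
have [I0 ID IM] := ideal_gen_ideal G.
move=> p e [j [c [g [hg ->]]]]; rewrite raddf_sum /=.
apply: (big_ind _ I0 ID) => i _; have [d hd] := hG _ (hg i).
rewrite (pihomogM hd); case: ifP => // _.
by apply: IM; apply: ideal_gen_mem.
Qed.

Lemma mderivXn (i j : 'I_n) e :
  ('X_j ^+ e)^`M(i) = (if i == j then e%:R *: 'X_j ^+ e.-1 else 0) :> S.
Proof.
rewrite mpolyXn mderivX mulmnE mnm1E eq_sym; case: eqP => [->|_]; last first.
  by rewrite mul0n scale0r.
rewrite mul1n mpolyXn; case: e => [|e]; first by rewrite !scale0r.
congr (_ *: 'X_[_]); apply/mnmP => u; rewrite !(mnmBE, mulmnE, mnm1E) /=; lia.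
Qed.

Lemma mderivX1 (i j : 'I_n) : ('X_j)^`M(i) = (i == j)%:R :> S.
Proof. by rewrite -['X_j]expr1 mderivXn; case: eqP; rewrite // scale1r. Qed.

End HomogeneousIdeals.

Section Graded.
Context {n : nat} {k : fieldType}.
Local Notation S := {mpoly k[n]}.
Implicit Types (p q : S) (e d : int).

Definition hcomp e p : S := if e is Posz i then pihomog (@mdeg n) i p else 0.

Lemma homogz_pos i p : homogz i%:Z p <-> p \is i.-homog.
Proof.
split=> [h|/dhomogP h u hu]; last by rewrite (h u hu).
by apply/dhomogP => u /h /eqP; rewrite eqz_nat => /eqP.
Qed.

Lemma homogz_neg i p : homogz (Negz i) p -> p = 0.
Proof.
move=> h; apply/eqP; rewrite -msupp_eq0; case E: (msupp p) => [//|u s].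
by have /h : u \in msupp p by rewrite E inE eqxx.
Qed.

Lemma homogz0 e : homogz e (0 : S).
Proof. by move=> u; rewrite msupp0. Qed.

Lemma homogz_hcomp e p : homogz e (hcomp e p).
Proof. by case: e => [i|i] /=; [apply/homogz_pos/pihomogP|apply: homogz0]. Qed.

Lemma hcomp_id e p : homogz e p -> hcomp e p = p.
Proof.
by case: e => [i /homogz_pos|i /homogz_neg ->] //=; apply: pihomog_dE.
Qed.

Lemma hcomp_sum (T : finType) e (F : T -> S) :
  hcomp e (\sum_t F t) = \sum_t hcomp e (F t).
Proof.
case: e => [i|i] /=; first by rewrite raddf_sum.
by rewrite big1.
Qed.

Lemma hcompB e p q : hcomp e (p - q) = hcomp e p - hcomp e q.
Proof.
case: e => [i|i] /=; first by rewrite raddfB.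
by rewrite subr0.
Qed.

Lemma hcompM d e p q : homogz d q -> hcomp e (p * q) = hcomp (e - d) p * q.
Proof.
case: d => [d /homogz_pos hq|d /homogz_neg ->]; last first.
  by rewrite !mulr0; case: e => [i|i] //=; rewrite raddf0.
case: e => [e|e] /=; last first.
  by rewrite (_ : Negz e - d%:Z = Negz (e + d)) ?mul0r //; lia.
rewrite (pihomogM hq); case: leqP => h; first by rewrite subzn.
by rewrite (_ : e%:Z - d%:Z = Negz (d - e).-1) ?mul0r //; lia.
Qed.

Definition gmx r s (al : 'I_r -> int) (be : 'I_s -> int) (M : 'M[S]_(r, s)) :=
  forall a b, homogz (al a - be b) (M a b).

(** Replacing each entry of [U] by its component of the right degree does not affect a product that
    is already graded. *)
Lemma graded_factor r s t (al : 'I_r -> int) (be : 'I_s -> int) (ga : 'I_t -> int)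
    (M : 'M[S]_(r, t)) (D : 'M[S]_(s, t)) (U : 'M[S]_(r, s)) :
  gmx al ga M -> gmx be ga D -> M = U *m D ->
  exists U', gmx al be U' /\ M = U' *m D.
Proof.
move=> hM hD E; exists (\matrix_(a, b) hcomp (al a - be b) (U a b)); split.
  by move=> a b; rewrite mxE; apply: homogz_hcomp.
apply/matrixP => a c; rewrite -(hcomp_id (hM a c)) E !mxE hcomp_sum.
apply: eq_bigr => b _; rewrite mxE (hcompM _ _ (hD b c)); congr (hcomp _ _ * _).
by lia.
Qed.

Lemma gmxM r s t (al : 'I_r -> int) (be : 'I_s -> int) (ga : 'I_t -> int) M D :
  gmx al be M -> gmx be ga D -> gmx al ga (M *m D).
Proof.
move=> hM hD a c; rewrite mxE.
suff -> : \sum_j M a j * D j c = hcomp (al a - ga c) (\sum_j M a j * D j c).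
  exact: homogz_hcomp.
rewrite hcomp_sum; apply: eq_bigr => b _; rewrite (hcompM _ _ (hD b c)).
rewrite (_ : al a - ga c - (be b - ga c) = al a - be b); last by lia.
by rewrite hcomp_id.
Qed.

Lemma factor_rows r s t (M : 'M[S]_(r, t)) (D : 'M[S]_(s, t)) :
  (forall a, exists u, row a M = u *m D) -> exists U, M = U *m D.
Proof.
move=> /fin_all_exists[f hf]; exists (\matrix_a f a).
by apply/row_matrixP => a; rewrite row_mul rowK.
Qed.

End Graded.

Section Comparison.
Context {n : nat} {k : fieldType}.
Local Notation S := {mpoly k[n]}.
Variable I : S -> Prop.
Hypothesis I_homog : is_homogeneous_ideal I.
Implicit Types (F G : @graded_free_complex n k).

(* The cycles of F_i, where F_{-1} = S/I. *)
Definition cyc F i : 'rV[S]_(rk F i) -> Prop :=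
  match i with
  | 0 => fun v => I ((v *m aug F) 0 0)
  | i'.+1 => fun v => v *m diff F i' = 0
  end.

Lemma cyc_exact F i v : graded_free_resolution I F ->
  @cyc F i v <-> exists u, v = u *m diff F i.
Proof. by case: i v => [|i] v [_ _ h0 hS]; [apply: h0|apply: hS]. Qed.

Lemma diff_graded F i : graded_free_resolution I F ->
  gmx (@gdeg _ _ F i.+1) (@gdeg _ _ F i) (diff F i).
Proof. by move=> [[_ h] _ _ _] a b; apply: h. Qed.

Lemma diff_cyc F i u : graded_free_resolution I F -> @cyc F i (u *m diff F i).
Proof. by move=> hF; apply/cyc_exact => //; exists u. Qed.

Definition chain F G i (phi : 'M[S]_(rk F i, rk G i)) :=
  forall v, cyc v -> @cyc G i (v *m phi).

Lemma chain_lift F G i (phi : 'M[S]_(rk F i, rk G i)) :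
  graded_free_resolution I F -> graded_free_resolution I G ->
  gmx (@gdeg _ _ F i) (@gdeg _ _ G i) phi -> chain phi ->
  exists phi' : 'M[S]_(rk F i.+1, rk G i.+1),
    [/\ gmx (@gdeg _ _ F i.+1) (@gdeg _ _ G i.+1) phi', chain phi'
      & diff F i *m phi = phi' *m diff G i].
Proof.
move=> hF hG gphi cphi.
have [U hU] : exists U, diff F i *m phi = U *m diff G i.
  apply: factor_rows => a; rewrite row_mul; apply/(cyc_exact _ hG).
  by apply: cphi; rewrite rowE; apply: diff_cyc.
have [phi' [g' E]] := graded_factor (gmxM (@diff_graded F i hF) gphi)
  (@diff_graded G i hG) hU.
by exists phi'; split=> // v /= hv; rewrite -mulmxA -E mulmxA hv mul0mx.
Qed.

Let II : is_ideal I := I_homog.1.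

Lemma aug_lift F G :
  graded_free_resolution I F -> graded_free_resolution I G ->
  exists phi : 'M[S]_(rk F 0, rk G 0),
    [/\ gmx (@gdeg _ _ F 0%N) (@gdeg _ _ G 0%N) phi, chain phi
      & forall a, I ((phi *m aug G - aug F) a 0)].
Proof.
have [I0 ID IM] := II.
move=> [[hFa _] _ _ _] [[hGa _] [v hv] _ _].
(* Since [v] maps to 1 in the quotient, sending the basis element [a] to [aug F a 0] times [v]
   respects the augmentations; [phi] is its graded part. *)
pose U : 'M[S]_(rk F 0, rk G 0) := \matrix_(a, b) (aug F a 0 * v 0 b).
pose phi : 'M[S]_(rk F 0, rk G 0) :=
  \matrix_(a, b) hcomp (gdeg a - gdeg b) (U a b).
have hU a : I ((U *m aug G - aug F) a 0).
  have -> : (U *m aug G - aug F) a 0 = aug F a 0 * ((v *m aug G) 0 0 - 1).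
    rewrite !mxE mulrBr mulr1 mulr_sumr; congr (_ - _).
    by apply: eq_bigr => b _; rewrite mxE mulrA.
  exact: IM.
have hphi a : I ((phi *m aug G - aug F) a 0).
  have -> : (phi *m aug G - aug F) a 0 = hcomp (gdeg a) ((U *m aug G - aug F) a 0).
    have sE (A B : 'cV[S]_(rk F 0)) : (A - B) a 0 = A a 0 - B a 0 by rewrite !mxE.
    rewrite (sE (phi *m aug G)) (sE (U *m aug G)) hcompB (hcomp_id (hFa a)).
    congr (_ - _).
    rewrite [LHS]mxE [in RHS]mxE hcomp_sum.
    by apply: eq_bigr => b _; rewrite mxE (hcompM _ _ (hGa b)).
  by case: (gdeg a) => [e|e] /=; [apply: I_homog.2|].
exists phi; split=> //; first by move=> a b; rewrite mxE; apply: homogz_hcomp.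
move=> u /= hu.
have -> : (u *m phi *m aug G) 0 0 = (u *m aug F) 0 0
    + \sum_a u 0 a * (phi *m aug G - aug F) a 0.
  rewrite -mulmxA -[phi *m aug G](subrK (aug F)) mulmxDr [LHS]mxE addrC.
  by congr (_ + _); rewrite mxE; apply: eq_bigr => a _; rewrite subrK.
have hs : I (\sum_a u 0 a * (phi *m aug G - aug F) a 0).
  by apply: (big_ind I I0 ID) => a _; apply: IM.
exact: (ID _ _ hu hs).
Qed.

(* The summand d_{i-1} h_{i-1} of a homotopy; unlike the vanishing on cycles of F,
   this form survives the reduction modulo the irrelevant ideal. *)
Definition vanishes_on_cycles F i : 'M[S]_(rk F i) -> Prop :=
  match i with
  | 0 => fun N => N = 0
  | i'.+1 => fun N => exists K, N = diff F i' *m K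
  end.

(** The chain maps and the homotopy are built together by induction on [i]; the summand [N] in
    degree [i.+1] is the differential followed by the homotopy of degree [i]. *)
Lemma comparison F G i :
  graded_free_resolution I F -> graded_free_resolution I G ->
  exists (phi : 'M[S]_(rk F i, rk G i)) (psi : 'M[S]_(rk G i, rk F i)) h N,
    [/\ gmx (@gdeg _ _ F i) (@gdeg _ _ G i) phi, chain phi,
        gmx (@gdeg _ _ G i) (@gdeg _ _ F i) psi /\ chain psi,
        phi *m psi - 1%:M = h *m diff F i + N
      & @vanishes_on_cycles F i N].
Proof.
move=> hF hG; have [I0 ID IM] := II.
elim: i => [|i [phi [psi [h [N [gphi cphi [gpsi cpsi] E hN]]]]]].
  have [phi [gphi cphi aphi]] := aug_lift hF hG.
  have [psi [gpsi cpsi apsi]] := aug_lift hG hF.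
  suff [h hh] : exists h, phi *m psi - 1%:M = h *m diff F 0.
    by exists phi, psi, h, 0; split=> //; rewrite addr0.
  apply: factor_rows => a; apply/(cyc_exact (i := 0) _ hF) => /=.
  have -> : (row a (phi *m psi - 1%:M) *m aug F) 0 0 =
      (phi *m aug G - aug F) a 0 + \sum_b phi a b * (psi *m aug F - aug G) b 0.
    rewrite -row_mul mxE mulmxBl mul1mx -mulmxA.
    have -> : phi *m (psi *m aug F) - aug F =
      phi *m aug G - aug F + phi *m (psi *m aug F - aug G).
      by rewrite mulmxBr [RHS]addrC addrA subrK.
    by rewrite mxE; congr (_ + _); rewrite mxE.
  by apply: (ID); [exact: aphi|apply: (big_ind I I0 ID) => b _; apply: IM].
have [phi' [gphi' cphi' Ephi]] := chain_lift hF hG gphi cphi.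
have [psi' [gpsi' cpsi' Epsi]] := chain_lift hG hF gpsi cpsi.
have [h' hh'] : exists h', phi' *m psi' - 1%:M - diff F i *m h = h' *m diff F i.+1.
  apply: factor_rows => a; apply/(cyc_exact (i := i.+1) _ hF) => /=.
  rewrite -row_mul (_ : _ *m diff F i = 0) ?row0 //.
  have -> : (phi' *m psi' - 1%:M - diff F i *m h) *m diff F i =
      diff F i *m (phi *m psi - 1%:M - h *m diff F i).
    rewrite !mulmxBl mul1mx -mulmxA -Epsi [phi' *m _]mulmxA -Ephi.
    by rewrite !mulmxBr mulmx1 !mulmxA.
  (* What remains is [diff F i *m N]. It vanishes because [N] is zero or starts with the preceding
     differential. *)
  rewrite E addrAC subrr add0r.
  case: i N hN {a phi psi h gphi cphi gpsi cpsi E phi' gphi' cphi' Ephi psi' gpsi' cpsi' Epsi}.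
    by move=> N /= ->; rewrite mulmx0.
  move=> i N /= [K ->]; rewrite mulmxA.
  suff -> : diff F i.+1 *m diff F i = 0 by rewrite mul0mx.
  apply/row_matrixP => b; rewrite row0 row_mul rowE.
  exact: (@diff_cyc F i.+1).
exists phi', psi', h', (diff F i *m h); split=> //; last by exists h.
by rewrite -hh' subrK.
Qed.

Local Notation red := (map_mx (mcoeff 0%MM)).

Lemma homogz_mcoeff0 e (p : S) : homogz e p -> p@_0%MM != 0 -> e = 0.
Proof. by rewrite -mcoeff_msupp => h /h; rewrite mdeg0. Qed.

(** The homotopy shows that [v *m red phi] is nonzero, as [v] is no boundary. An entry of [phi] with
    nonzero constant term joins basis elements of equal degree. *)
Lemma tor_generator F G i j (v : 'rV[k]_(rk F i)) :
  graded_free_resolution I F -> graded_free_resolution I G ->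
  (forall a, v 0 a != 0 -> gdeg a = j) -> cycle_k v -> ~ boundary_k v ->
  generator_in_degree G i j.
Proof.
move=> hF hG hv cv bv.
have [phi [psi [h [N [gphi _ _ E hN]]]]] := comparison i hF hG.
have Ek : red phi *m red psi - 1%:M = red h *m diff_k F i + red N.
  by have := congr1 red E; rewrite map_mxB map_mxD !map_mxM map_mx1.
have vN : v *m red N = 0.
  case: i v cv N hN {hv bv phi psi h gphi E Ek} => [|i] v cv N /=.
    by move=> ->; rewrite map_mx0 mulmx0.
  by move=> [K ->]; rewrite map_mxM mulmxA cv mul0mx.
have v0 : v *m red phi != 0.
  apply/eqP => v0; apply: bv; exists (- (v *m red h)).
  have := congr1 (mulmx v) Ek.
  rewrite mulmxBr mulmxDr !mulmxA v0 mul0mx vN addr0 mulmx1 sub0r => hvv.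
  by rewrite mulNmx; apply: oppr_inj; rewrite opprK.
have [b hb] : exists b, (v *m red phi) 0 b != 0.
  apply/existsP; apply: contraR v0 => /existsPn h0.
  by apply/eqP/rowP => b; rewrite [RHS]mxE; apply/eqP; rewrite -[_ == _]negbK.
exists b.
have [a ha] : exists a, v 0 a * (red phi) a b != 0.
  apply/existsP; apply: contraR hb => /existsPn h0.
  by rewrite mxE big1 // => a _; apply/eqP; rewrite -[_ == _]negbK.
move: ha; rewrite mulf_eq0 negb_or => /andP[/hv <-].
rewrite mxE => /(homogz_mcoeff0 (gphi a b)) /eqP.
by rewrite subr_eq0 => /eqP.
Qed.

Lemma irrelevant_mcoeff0 (p : S) : irrelevant_ideal p -> p@_0%MM = 0.
Proof.
apply: (ideal_gen_min (I := fun p : S => p@_0%MM = 0)).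
  split=> [|p1 p2 h1 h2|p1 p2 h2]; first by rewrite mcoeff0.
    by rewrite mcoeffD h1 h2 addr0.
  by rewrite rmorphM /= h2 mulr0.
by move=> q [i ->]; rewrite mcoeffX mnm1_eq0.
Qed.

Lemma minimal_generator_tor F i j : minimal_graded_free_resolution I F ->
  generator_in_degree F i j ->
  exists v : 'rV[k]_(rk F i),
    [/\ (forall a, v 0 a != 0 -> gdeg a = j), cycle_k v & ~ boundary_k v].
Proof.
move=> [hF hmin] [b hb].
have d0 u : diff_k F u = 0.
  by apply/matrixP => a c; rewrite !mxE; apply/irrelevant_mcoeff0/hmin.
exists (delta_mx 0 b); split.
- by move=> a; rewrite mxE eqxx /=; case: (eqVneq a b) => [-> _ //|_]; rewrite eqxx.
- by case: i b hb => [|i] b hb //=; rewrite d0 mulmx0.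
move=> [u]; rewrite d0 mulmx0 => /matrixP/(_ 0 b)/eqP.
by rewrite !mxE !eqxx oner_eq0.
Qed.

Lemma minimal_generator F G i j : minimal_graded_free_resolution I F ->
  graded_free_resolution I G -> generator_in_degree F i j -> generator_in_degree G i j.
Proof.
move=> hF hG /(minimal_generator_tor hF)[v [h1 h2 h3]].
exact: (@tor_generator F G i j v hF.1).
Qed.

Lemma tor_minimal F i j : minimal_graded_free_resolution I F ->
  tor_neq0 I i j <-> generator_in_degree F i j.
Proof.
move=> hF; split=> [[G [hG [v [h1 h2 h3]]]]|/(minimal_generator_tor hF) h].
  exact: (@tor_generator G F i j v hG hF.1).
by exists F; split; first exact: hF.1.
Qed.

End Comparison.

(** * Ideals generated by d-sequences are of linear type *)

Lemma sum_ord_pad (W : nmodType) (F : nat -> W) N M :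
  (forall r, (N <= r)%N -> F r = 0) -> (N <= M)%N ->
  \sum_(r < M) F r = \sum_(r < N) F r.
Proof.
move=> hz hNM; rewrite -!(big_mkord xpredT) (big_cat_nat (leq0n N) hNM) /=.
rewrite [X in _ + X]big_nat_cond [X in _ + X]big1 ?addr0 // => r /andP[/andP[hr _] _].
exact: hz.
Qed.

Section DSequence.
Import monalg.
Context {A : comNzRingType} (J : A -> Prop) (gs : seq A).
Hypothesis J_span : forall p, J p <-> idspan gs p.
Local Notation Q := (free_alg J).
Local Notation Rel := (ideal_gen (@sym_relation A J)).
Local Notation iota s := (mkmalgU mone s : Q).

Let RelI : is_ideal Rel := ideal_gen_ideal (@sym_relation A J).
Let J_ideal : is_ideal J.
Proof.
have -> : J = idspan gs by apply/funext => p; apply/propext.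
exact: idspan_ideal.
Qed.

Lemma RelB (P P' : Q) : Rel P -> Rel P' -> Rel (P - P').
Proof.
by move=> h h'; case: RelI => _ ID IM; rewrite -mulN1r; apply: ID => //; apply: IM.
Qed.

Lemma Rel_trans (P P' P'' : Q) : Rel (P - P') -> Rel (P' - P'') -> Rel (P - P'').
Proof. by move=> h h'; rewrite -(subrKA P'); case: RelI => _ ID _; apply: ID. Qed.

Lemma Rel_sym (P P' : Q) : Rel (P - P') -> Rel (P' - P).
Proof. by move=> h; rewrite -opprB -sub0r; apply: RelB => //; case: RelI. Qed.

(** The variable attached to [a], with default 0 outside [J]; this frees later formulas from
    membership proofs. *)
Definition symb (a : A) : Q :=
  if pselect (J a) is left h then free_var (exist _ a (asboolT h) : ideal_elt J)
  else 0.

Lemma symbE (a : ideal_elt J) : free_var a = symb (val a).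
Proof.
rewrite /symb; case: pselect => [h|]; last by case; apply/asboolP; exact: (valP a).
by congr free_var; apply: val_inj.
Qed.

Lemma symb_elt a : J a -> exists a' : ideal_elt J, val a' = a.
Proof. by move=> h; exists (exist _ a (asboolT h) : ideal_elt J). Qed.

Lemma symbD a b : J a -> J b -> Rel (symb (a + b) - (symb a + symb b)).
Proof.
move=> ha hb; have hab : J (a + b) by case: J_ideal => _ ID _; apply: ID.
have [c' hc] := symb_elt hab; have [a' ha'] := symb_elt ha; have [b' hb'] := symb_elt hb.
move: hc; rewrite -ha' -hb' => hc.
apply: ideal_gen_mem; left; exists a', b', c'; split; first exact: hc.
by rewrite -!symbE -hc -symbE opprD addrA.
Qed.

Lemma symbZ s a : J a -> Rel (symb (s * a) - iota s * symb a).
Proof.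
move=> ha; have hsa : J (s * a) by case: J_ideal => _ _ IM; apply: IM.
have [c' hc] := symb_elt hsa; have [a' ha'] := symb_elt ha.
move: hc; rewrite -ha' => hc.
apply: ideal_gen_mem; right; exists s, a', c'; split; first exact: hc.
by rewrite -symbE -hc -symbE.
Qed.

Lemma iotaM s t : iota (s * t) = iota s * iota t.
Proof. exact: mpolyCM. Qed.

Lemma iotaD s t : iota (s + t) = iota s + iota t.
Proof. exact: monalgUD. Qed.

Lemma symb0 : Rel (symb 0).
Proof.
have J0 : J 0 by case: J_ideal.
have := symbZ 0 J0; rewrite mulr0.
have -> : iota 0 = 0 by apply: monalgU0.
by rewrite mul0r subr0.
Qed.

(** The presentation of [P] as a combination of variables [symb g] with coefficients in [F] is
    carried along with the value [v]. Restricting [hs] to an initial segment bounds which leading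
    variables occur. *)
Fixpoint span_form (F : Q -> A -> Prop) (hs : seq A) (P : Q) (v : A) : Prop :=
  if hs is g :: hs' then
    exists P1 v1 P2 v2, [/\ F P1 v1, span_form F hs' P2 v2,
      P = symb g * P1 + P2 & v = g * v1 + v2]
  else P = 0 /\ v = 0.

(* [form r P v]: P is a form of degree r in the T_g, g \in gs, and v is its value
   at the T_g = g. *)
Fixpoint form (r : nat) : Q -> A -> Prop :=
  if r is r'.+1 then span_form (form r') gs else fun P v => P = iota v.

Lemma span_formD F hs P P' v v' :
  (forall P P' v v', F P v -> F P' v' -> F (P + P') (v + v')) ->
  span_form F hs P v -> span_form F hs P' v' -> span_form F hs (P + P') (v + v').
Proof.
move=> FD; elim: hs P P' v v' => [|g hs IH] P P' v v' /=.
  by move=> [-> ->] [-> ->]; rewrite !addr0.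
move=> [P1 [v1 [P2 [v2 [h1 h2 -> ->]]]]] [Q1 [u1 [Q2 [u2 [k1 k2 -> ->]]]]].
exists (P1 + Q1), (v1 + u1), (P2 + Q2), (v2 + u2); split.
- exact: FD.
- exact: IH.
- by rewrite mulrDr addrACA.
- by rewrite mulrDr addrACA.
Qed.

Lemma span_formM (F F' : Q -> A -> Prop) hs P v (X : Q) (u : A) :
  (forall P v, F P v -> F' (X * P) (u * v)) ->
  span_form F hs P v -> span_form F' hs (X * P) (u * v).
Proof.
move=> FM; elim: hs P v => [|g hs IH] P v /=.
  by move=> [-> ->]; rewrite !mulr0.
move=> [P1 [v1 [P2 [v2 [h1 h2 -> ->]]]]].
exists (X * P1), (u * v1), (X * P2), (u * v2); split.
- exact: FM.
- exact: IH.
- by rewrite mulrDr mulrCA.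
- by rewrite mulrDr mulrCA.
Qed.

Lemma formD r P P' v v' : form r P v -> form r P' v' -> form r (P + P') (v + v').
Proof.
elim: r P P' v v' => [|r IH] P P' v v' /=; first by move=> -> ->; rewrite iotaD.
exact: span_formD.
Qed.

Lemma formM r s P v : form r P v -> form r (iota s * P) (s * v).
Proof.
elim: r P v => [|r IH] P v /=; first by move=> ->; rewrite iotaM.
exact: span_formM.
Qed.

Lemma span_form0 F hs : F 0 0 -> span_form F hs 0 0.
Proof.
move=> F0; elim: hs => //= g hs IH.
by exists 0, 0, 0, 0; split; rewrite // !mulr0 addr0.
Qed.

Lemma form0 r : form r 0 0.
Proof.
elim: r => [|r IH] /=; first by rewrite monalgU0.
exact: span_form0.
Qed.

Lemma formX r g P v : g \in gs -> form r P v -> form r.+1 (symb g * P) (g * v).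
Proof.
rewrite /=; elim: gs => //= h hs IH; rewrite inE => /orP[/eqP -> hP|hg hP].
  by exists P, v, 0, 0; split; rewrite ?addr0 //; apply/span_form0/form0.
exists 0, 0, (symb g * P), (g * v); split; rewrite ?mulr0 ?add0r //.
  exact: form0.
exact: IH.
Qed.

Lemma span_form_span F hs P v : span_form F hs P v -> idspan hs v.
Proof.
elim: hs P v => [|g hs IH] P v /=; first by case.
move=> [P1 [v1 [P2 [v2 [_ /IH h _ ->]]]]]; exists v1.
by have -> : g * v1 + v2 - v1 * g = v2 by ring.
Qed.

Lemma span_form_rcons F hs g P v : span_form F (rcons hs g) P v ->
  exists P1 v1 P2 v2, [/\ span_form F hs P1 v1, F P2 v2,
    P = P1 + symb g * P2 & v = v1 + g * v2].
Proof.
elim: hs P v => [|h hs IH] P v /=.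
  move=> [P1 [v1 [P2 [v2 [h1 [-> ->] -> ->]]]]].
  by exists 0, 0, P1, v1; split; rewrite // ?add0r ?addr0.
move=> [P1 [v1 [P2 [v2 [h1 /IH [Q1 [u1 [Q2 [u2 [k1 k2 -> ->]]]]] -> ->]]]]].
exists (symb h * P1 + Q1), (h * v1 + u1), Q2, u2; split=> //.
- by exists P1, v1, Q1, u1.
- by rewrite addrA.
- by rewrite addrA.
Qed.

Lemma linear_form hs v : (forall g, g \in hs -> J g) -> idspan hs v ->
  exists P, span_form (form 0) hs P v /\ Rel (symb v - P).
Proof.
elim: hs v => [|g hs IH] v hJ /=.
  by move=> ->; exists 0; split=> //; rewrite subr0; apply: symb0.
have hJ' h : h \in hs -> J h by move=> hh; apply: hJ; rewrite inE hh orbT.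
have Jg : J g by apply: hJ; rewrite inE eqxx.
move=> [c hc]; have [P [hP hr]] := IH _ hJ' hc.
have Jcg : J (c * g) by case: J_ideal => _ _; apply.
have Jv : J (v - c * g) := idspanP J_ideal hJ' hc.
exists (symb g * iota c + P); split.
  exists (iota c), c, P, (v - c * g); split=> //.
  by rewrite [g * c]mulrC addrC subrK.
have := symbD Jcg Jv; rewrite (_ : c * g + (v - c * g) = v); last by ring.
move=> h; apply: Rel_trans h _.
have := symbZ c Jg; rewrite [iota c * _]mulrC => h.
by case: RelI => _ ID _; rewrite opprD addrACA; apply: ID.
Qed.

Hypothesis d_sequence : forall i p, (i < size gs)%N ->
  idspan (take i gs) (nth 0 gs i * p) -> idspan gs p -> idspan (take i gs) p.

Let J_take i g : g \in take i gs -> J g.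
Proof. by move=> /mem_take hg; apply/J_span/idspan_mem. Qed.

(** Leading variables are eliminated from the last one down to index [i]. If [P = P1 + symb g * P2]
    with [g] the last generator left, then [g] times the value of [P2] lies in the ideal of the
    earlier generators, and [step] rewrites that summand. *)
Lemma form_descent_step r :
  (forall l P v, (l < size gs)%N -> form r P v ->
     idspan (take l gs) (nth 0 gs l * v) ->
     exists P', span_form (form r) (take l gs) P' (nth 0 gs l * v) /\
       Rel (symb (nth 0 gs l) * P - P')) ->
  forall i P v, (i <= size gs)%N -> form r.+1 P v -> idspan (take i gs) v ->
  exists P', span_form (form r) (take i gs) P' v /\ Rel (P - P').
Proof.
have [R0 RD RM] := RelI.
move=> step i P v hi hP hv.
suff h j : (j <= size gs - i)%N -> exists P',
    span_form (form r) (take (size gs - j) gs) P' v /\ Rel (P - P').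
  by have := h _ (leqnn _); rewrite subKn.
elim: j => [_|j IHj hj]; first by exists P; rewrite subn0 take_size subrr.
have [P' []] := IHj (ltnW hj).
have -> : (size gs - j = (size gs - j.+1).+1)%N by lia.
have hl : (size gs - j.+1 < size gs)%N by lia.
have hil : (i <= size gs - j.+1)%N by lia.
move: (size gs - j.+1)%N hl hil => l hl hil {IHj hj}.
have hvl : idspan (take l gs) v.
  apply: idspan_sub hv => g.
  by rewrite -(take_takel _ hil) => /mem_take; apply: idspan_mem.
rewrite (take_nth 0 hl) => /span_form_rcons[P1 [v1 [P2 [v2 [h1 h2 EP' Ev]]]]] hPP'.
have hgv : idspan (take l gs) (nth 0 gs l * v2).
  have -> : nth 0 gs l * v2 = v - v1 by rewrite Ev; ring.
  exact: idspanB hvl (span_form_span h1).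
have [P3 [h3 hr3]] := step _ _ _ hl h2 hgv.
exists (P1 + P3); split; first by rewrite Ev; apply: span_formD h1 h3 => *; apply: formD.
by apply: Rel_trans hPP' _; rewrite EP' opprD addrACA subrr add0r.
Qed.

(** For constant [P2] the rewriting is linearity of [symb]. In positive degree the value of [P2]
    lies in the whole ideal, so the d-sequence condition moves it into the ideal of earlier
    generators and the induction on [r] applies. *)
Lemma form_descent r i P v : (i <= size gs)%N ->
  form r.+1 P v -> idspan (take i gs) v ->
  exists P', span_form (form r) (take i gs) P' v /\ Rel (P - P').
Proof.
have [R0 RD RM] := RelI.
elim: r i P v => [|r IHr]; apply: form_descent_step => l P v hl hP hgv.
  have Jl : J (nth 0 gs l) by apply/J_span/idspan_mem/mem_nth.
  have [P3 [h3 hr3]] := linear_form (@J_take l) hgv.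
  exists P3; split=> //; rewrite hP mulrC; apply: Rel_trans hr3.
  by apply: Rel_sym; rewrite [_ * v]mulrC; apply: symbZ.
have hv : idspan (take l gs) v.
  by apply: d_sequence => //; apply: span_form_span hP.
have [P3 [h3 hr3]] := IHr _ _ _ (ltnW hl) hP hv.
exists (symb (nth 0 gs l) * P3); split; last by rewrite -mulrBr; apply: RM.
by apply: span_formM h3 => Q' u; apply: formX; apply: mem_nth.
Qed.

(** The value 0 lies in the ideal of the empty segment, so the descent removes every leading
    variable. *)
Lemma form_eq0 r P : form r P 0 -> Rel P.
Proof.
case: r => [|r] hP; first by rewrite hP monalgU0; case: RelI.
have [P' []] : exists P', span_form (form r) (take 0 gs) P' 0 /\ Rel (P - P').
  by apply: form_descent hP _; rewrite ?take0.
by rewrite take0 => -[-> _]; rewrite subr0.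
Qed.

Let mon (m : cmonom (ideal_elt J)) : {poly A} :=
  \prod_(a <- finsupp (cmonom_val m)) (val a *: 'X) ^+ m a.

Lemma monE (d : {fset ideal_elt J}) (m : cmonom (ideal_elt J)) :
  (finsupp (cmonom_val m) `<=` d)%fset -> mon m = \prod_(a <- d) (val a *: 'X) ^+ m a.
Proof.
move=> hd; rewrite /mon; apply/big_fset_incl => // a _.
by rewrite -cmE_eq0 => /eqP ->.
Qed.

Lemma monM m1 m2 : mon (mmul m1 m2) = mon m1 * mon m2.
Proof.
rewrite (@monE (finsupp m1 `|` finsupp m2)%fset (mmul m1 m2)) ?mdomD //.
rewrite (@monE (finsupp m1 `|` finsupp m2)%fset m1) ?fsubsetUl //.
rewrite (@monE (finsupp m1 `|` finsupp m2)%fset m2) ?fsubsetUr //.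
by rewrite -big_split; apply: eq_bigr => a _; rewrite cmM exprD.
Qed.

Lemma monU a : mon (ucm a) = val a *: 'X.
Proof. by rewrite /mon mdomU big_seq_fset1 cmUU. Qed.

Lemma mon1 : mon mone = 1.
Proof. by rewrite /mon mdom1 big_seq_fset0. Qed.

Lemma monomial_form m : exists r P v,
  [/\ form r P v, Rel ((mkmalgU m 1 : Q) - P) & mon m = v *: 'X^r].
Proof.
have [R0 RD RM] := RelI.
move: {2}(mdeg m) (erefl (mdeg m)) => e; elim: e m => [|e IH] m hm.
  exists 0%N, 1, 1; rewrite (mdeg_eq0I hm); split.
  - by [].
  - by rewrite subrr.
  - by rewrite mon1 scale1r expr0.
have [a ha] : exists a, m a != 0%N.
  case: (fset_0Vmem (finsupp m)) => [E|[a ha]].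
    by move: hm; rewrite mdegE E big_seq_fset0.
  by exists a; rewrite cmE_neq0.
pose m' := divcm m (ucm a).
have Em : m = mmul (ucm a) m'.
  apply/eqP/cmP => i; rewrite cmM /m' divcmE cmU.
  by case: eqVneq => [<-|_]; [move: ha; case: (m a) => // u; rewrite add1n subn1|rewrite subn0].
have hm' : mdeg m' = e by move: hm; rewrite Em mdegM mdegU add1n => -[].
have [r [P [v [hP hR hv]]]] := IH _ hm'.
have Ja : J (val a) by apply/asboolP; exact: (valP a).
have [L [hL hRL]] := linear_form (fun g hg => (J_span g).2 (idspan_mem hg))
  ((J_span (val a)).1 Ja).
exists r.+1, (P * L), (v * val a); split.
- apply: span_formM hL => Q' u /= ->; rewrite mulrC [v * u]mulrC; exact: formM.
- have -> : (mkmalgU m 1 : Q) = mkmalgU m' 1 * free_var a.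
    rewrite Em /free_var mulrC malgM_def fgmulUU mulr1 //.
  rewrite symbE; apply: Rel_trans (_ : Rel (_ - P * symb (val a))) _.
    by rewrite -mulrBl mulrC; apply: RM.
  by rewrite -mulrBr; apply: RM.
by rewrite Em monM monU hv -!scalerAl -scalerAr scalerA mulrC -exprS mulrC.
Qed.

Definition decomposable (P : Q) := exists N (F : nat -> Q) (v : nat -> A),
  [/\ forall r, form r (F r) (v r), forall r, (N <= r)%N -> F r = 0 /\ v r = 0,
    Rel (P - \sum_(r < N) F r) & rees_map P = \sum_(r < N) v r *: 'X^r].

Lemma form_decomp (P : Q) : decomposable P.
Proof.
have [R0 RD RM] := RelI.
rewrite [P]monalgE; apply: (big_ind decomposable).
- exists 0%N, (fun=> 0), (fun=> 0); split=> //.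
  + by move=> r; apply: form0.
  + by rewrite big_ord0 subrr.
  + by rewrite big_ord0 /rees_map mmap0.
- move=> P1 P2 [N1 [F1 [v1 [f1 z1 r1 e1]]]] [N2 [F2 [v2 [f2 z2 r2 e2]]]].
  exists (N1 + N2)%N, (fun r => F1 r + F2 r), (fun r => v1 r + v2 r); split.
  + by move=> r; apply: formD.
  + move=> r hr; have [-> ->] := z1 r (leq_trans (leq_addr _ _) hr).
    by have [-> ->] := z2 r (leq_trans (leq_addl _ _) hr); rewrite !addr0.
  + rewrite big_split /= (@sum_ord_pad _ F1 N1) ?leq_addr //; last by move=> r /z1[].
    rewrite (@sum_ord_pad _ F2 N2) ?leq_addl //; last by move=> r /z2[].
    by rewrite opprD addrACA; apply: RD.
  + under eq_bigr => r _ do rewrite scalerDl.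
    rewrite big_split /= (@sum_ord_pad _ (fun r => v1 r *: 'X^r) N1) ?leq_addr //; last first.
      by move=> r /z1[_ ->]; rewrite scale0r.
    rewrite (@sum_ord_pad _ (fun r => v2 r *: 'X^r) N2) ?leq_addl //; last first.
      by move=> r /z2[_ ->]; rewrite scale0r.
    by rewrite -e1 -e2 /rees_map mmapD.
move=> m _; have [r [F [v [hF hR hv]]]] := monomial_form m.
set c := mcoeff m P.
exists r.+1, (fun i => if i == r then iota c * F else 0), (fun i => if i == r then c * v else 0).
split.
- by move=> i; case: eqP => [->|_]; [apply: formM|apply: form0].
- by move=> i hi; rewrite gtn_eqF.
- rewrite big_ord_recr /= eqxx big1 ?add0r; last by move=> i _; rewrite ltn_eqF.
  have -> : (mkmalgU m c : Q) = iota c * mkmalgU m 1.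
    by rewrite malgM_def fgmulUU mulr1 mul1m.
  by rewrite -mulrBr; apply: RM.
rewrite big_ord_recr /= eqxx big1 ?add0r; last by move=> i _; rewrite ltn_eqF // scale0r.
by rewrite /rees_map mmapU -/(mon m) hv -mul_polyC mulrA -polyCM mul_polyC.
Qed.

Theorem linear_type_of_d_sequence : linear_type J.
Proof.
have [R0 RD RM] := RelI.
move=> P hP; have [N [F [v [hF _ hR hv]]]] := form_decomp P.
rewrite -[P](subrK (\sum_(r < N) F r)); apply: (RD) => //.
apply: (big_ind Rel R0 RD) => r _.
suff E : v r = 0 by apply: (@form_eq0 r); rewrite -E.
(* The degree [r] coefficient of the Rees image is the value of the degree [r] form. *)
have := congr1 (fun p : {poly A} => p`_r) hv; rewrite hP coef0 coef_sum (bigD1 r) //=.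
rewrite coefZ coefXn eqxx mulr1 big1 ?addr0 // => i hi.
by rewrite coefZ coefXn eq_sym (negPf hi : (nat_of_ord i == r) = false) mulr0.
Qed.

End DSequence.

(** * The surface x^d y + y^d z + z^d w = 0 *)

Section Surface.
Context {k : fieldType} (m : nat).
Local Notation S := {mpoly k[4]}.
Local Notation ix := (@Ordinal 4 0 isT).
Local Notation iy := (@Ordinal 4 1 isT).
Local Notation iz := (@Ordinal 4 2 isT).
Local Notation iw := (@Ordinal 4 3 isT).
Local Notation x := ('X_ix : S).
Local Notation y := ('X_iy : S).
Local Notation z := ('X_iz : S).
Local Notation w := ('X_iw : S).
Local Notation V := (mpoly_setting k).
Implicit Types (p q : S).
Local Notation f0 := (x ^+ m.+2 * y + y ^+ m.+2 * z).
Local Notation f := (f0 + z ^+ m.+2 * w).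

(** * The quotient by [f] is a normal domain *)

Definition wfree p := kill iw p = p.

Lemma wfreeX i : i != iw -> wfree 'X_i.
Proof. by rewrite /wfree killX eq_sym => /negPf ->. Qed.

Lemma wfreeC c : wfree c%:MP. Proof. exact: killC. Qed.

Lemma wfree0 : wfree 0. Proof. exact: kill0. Qed.

Lemma wfreeD p q : wfree p -> wfree q -> wfree (p + q).
Proof. by rewrite /wfree killD => -> ->. Qed.

Lemma wfreeN p : wfree p -> wfree (- p).
Proof. by rewrite /wfree killN => ->. Qed.

Lemma wfreeM p q : wfree p -> wfree q -> wfree (p * q).
Proof. by rewrite /wfree killM => -> ->. Qed.

Lemma wfreeXn p e : wfree p -> wfree (p ^+ e).
Proof. by rewrite /wfree killXn => ->. Qed.

Lemma wfree_f0 : wfree f0.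
Proof. by apply: wfreeD; apply: wfreeM; try apply: wfreeXn; apply: wfreeX. Qed.

Lemma wfree_z e : wfree (z ^+ e).
Proof. exact/wfreeXn/wfreeX. Qed.

(* Substituting a high power of [w] for [w] fixes [p] but makes the degree of
   [f] exceed that of [p]. *)
Lemma wfree_multiple p : wfree p -> idspan [:: f] p -> p = 0.
Proof.
move=> hp [h /eqP]; rewrite subr_eq0 => /eqP E; apply/eqP/negP => /negP p0.
pose N := msize p.
pose s := subst (fun j => if j == iw then w ^+ N else 'X_j : S).
have sD q r : s (q + r) = s q + s r by exact: rmorphD.
have sM q r : s (q * r) = s q * s r by exact: rmorphM.
have sXn q e : s (q ^+ e) = s q ^+ e by exact: rmorphXn.
have sk q : s (kill iw q) = kill iw q.
  elim/(@mpoly_gen_ind 4 k): q => [c|j|q r hq hr|q r hq hr].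
  - by rewrite killC /s substC.
  - rewrite killX; case: eqP => [_|/eqP hj]; first exact: rmorph0.
    by rewrite /s substX eq_sym (negPf hj).
  - by rewrite killD sD hq hr.
  - by rewrite killM sM hq hr.
have Es : p = s h * s f by rewrite -sM -E -hp sk.
have sX j : j != iw -> s 'X_j = 'X_j by rewrite /s substX => /negPf ->.
have sw : s w = w ^+ N by rewrite /s substX eqxx.
have h0 : s h != 0 by apply: contraNneq p0 => h0; rewrite Es h0 mul0r.
have f0 : s f != 0 by apply: contraNneq p0 => f0; rewrite Es f0 mulr0.
have sz : (msize (s f) <= N)%N.
  rewrite /N Es msizeM // (mpolySpred _ h0) addSn /= leq_addl //.
suff : (N < msize (s f))%N by rewrite ltnNge sz.
pose M : 'X_{1..4} := (U_(iz) *+ m.+2 + U_(iw) *+ N)%MM.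
have hM : M \in msupp (s f).
  have sT i j : s ('X_i ^+ m.+2 * 'X_j) = s 'X_i ^+ m.+2 * s 'X_j.
    by rewrite sM sXn.
  rewrite mcoeff_msupp !sD !sT sw !sX // !mpolyXn -!mpolyXD !mcoeffD !mcoeffX.
  have -> : ((U_(ix) *+ m.+2 + U_(iy) == M) = false)%MM.
    by apply/eqP => /mnmP/(_ ix); rewrite !(mnmDE, mulmnE, mnm1E) /=; lia.
  have -> : ((U_(iy) *+ m.+2 + U_(iz) == M) = false)%MM.
    by apply/eqP => /mnmP/(_ iy); rewrite !(mnmDE, mulmnE, mnm1E) /=; lia.
  by rewrite eqxx !add0r oner_neq0.
apply: leq_ltn_trans (msize_mdeg_lt hM).
by rewrite mdegD !mdegMn !mdeg1; lia.
Qed.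

Lemma idspan1_ideal : is_ideal (idspan [:: f]).
Proof. exact: idspan_ideal. Qed.

Lemma kill_f i : kill i f =
  kill i x ^+ m.+2 * kill i y + kill i y ^+ m.+2 * kill i z
  + kill i z ^+ m.+2 * kill i w.
Proof.
have t j l : kill i ('X_j ^+ m.+2 * 'X_l) = kill i 'X_j ^+ m.+2 * kill i 'X_l.
  by rewrite killM killXn.
by rewrite !killD !t.
Qed.

Lemma kill_z_f_neq0 : kill iz f != 0.
Proof.
rewrite kill_f !killX /= mulr0 expr0n mul0r !addr0.
by rewrite mulf_neq0 ?expf_neq0 ?X_neq0.
Qed.

Lemma cop_fz : cop f z.
Proof. exact: (@cop_var _ V iz) kill_z_f_neq0. Qed.

Lemma cancel_z p e : idspan [:: f] (z ^+ e * p) -> idspan [:: f] p.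
Proof.
move=> [h /eqP]; rewrite subr_eq0 => /eqP E.
have [r hr] : exists r, h = z ^+ e * r.
  by apply: (cop_expr cop_fz (q := p)); rewrite mulrC -E.
exists r; apply: (mulfI (expf_neq0 e (X_neq0 iz))).
by rewrite mulr0 mulrBr E hr -mulrA subrr.
Qed.

(** Modulo [f], [z ^+ m.+2 * w] equals [- f0]. All large exponents are allowed so that several
    elements can share one. *)
Lemma clear_w p : exists N, forall e, (N <= e)%N ->
  exists q, wfree q /\ idspan [:: f] (z ^+ (m.+2 * e) * p - q).
Proof.
suff [N [q [hq hp]]] : exists N q,
    wfree q /\ idspan [:: f] (z ^+ (m.+2 * N) * p - q).
  exists N => e he; exists (z ^+ (m.+2 * (e - N)) * q); split.
    by apply: wfreeM => //; apply: wfree_z.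
  rewrite -{1}(subnK he) mulnDr exprD -mulrA -mulrBr; exact: idspanM.
have hI := idspan1_ideal.
elim/(@mpoly_gen_ind 4 k): p => [c|j|p1 p2|p1 p2].
- exists 0%N, c%:MP; split; first exact: wfreeC.
  by rewrite muln0 mul1r subrr; apply: idspan0.
- case: (eqVneq j iw) => [->|hj]; last first.
    exists 0%N, 'X_j; split; first exact: wfreeX.
    by rewrite muln0 mul1r subrr; apply: idspan0.
  exists 1%N, (- f0); split; first exact/wfreeN/wfree_f0.
  by exists 1; rewrite mul1r muln1 opprK [z ^+ _ * w + _]addrC subrr.
- move=> [N1 [q1 [w1 h1]]] [N2 [q2 [w2 h2]]].
  exists (N1 + N2)%N, (z ^+ (m.+2 * N2) * q1 + z ^+ (m.+2 * N1) * q2); split.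
    by apply: wfreeD; apply: wfreeM => //; apply: wfree_z.
  have -> : z ^+ (m.+2 * (N1 + N2)) * (p1 + p2)
      - (z ^+ (m.+2 * N2) * q1 + z ^+ (m.+2 * N1) * q2)
    = z ^+ (m.+2 * N2) * (z ^+ (m.+2 * N1) * p1 - q1)
      + z ^+ (m.+2 * N1) * (z ^+ (m.+2 * N2) * p2 - q2).
    by rewrite mulnDr exprD; ring.
  by apply: idspanD; apply: idspanM.
move=> [N1 [q1 [w1 h1]]] [N2 [q2 [w2 h2]]].
exists (N1 + N2)%N, (q1 * q2); split; first exact: wfreeM.
rewrite mulnDr exprD mulrACA; exact: ideal_congM.
Qed.

(** After clearing [w], the product is a multiple of [f] free of [w], hence zero in a domain; powers
    of [z] then cancel. *)
Lemma f_prime p q :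
  idspan [:: f] (p * q) -> idspan [:: f] p \/ idspan [:: f] q.
Proof.
have hI := idspan1_ideal.
move=> h; have [N1 /(_ _ (leqnn _))[p' [wp hp]]] := clear_w p.
have [N2 /(_ _ (leqnn _))[q' [wq hq]]] := clear_w q.
have h' : idspan [:: f] (p' * q').
  rewrite -[p' * q'](subKr (z ^+ (m.+2 * N1) * p * (z ^+ (m.+2 * N2) * q))).
  apply: idspanB; first by rewrite mulrACA; apply: idspanM.
  exact: ideal_congM.
have /eqP := wfree_multiple (wfreeM wp wq) h'.
rewrite mulf_eq0 => /orP[] /eqP E; [left; move: hp|right; move: hq];
  by rewrite E subr0 => /cancel_z.
Qed.

Lemma z_notin e : ~ idspan [:: f] (z ^+ e).
Proof.
rewrite -[z ^+ e]mulr1 => /cancel_z /(wfree_multiple (killC _ _)) /eqP.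
by rewrite oner_eq0.
Qed.

Lemma fraction_z e (c : 'I_e -> S) a b : ~ idspan [:: f] b ->
  idspan [:: f] (homog_eqn c a b) ->
  exists M q, idspan [:: f] (z ^+ M * a - q * b).
Proof.
move=> hb hab; have hI := idspan1_ideal.
have [Na hNa] := clear_w a; have [Nb hNb] := clear_w b.
have [Nc hNc] : exists Nc : nat, forall i, exists q, wfree q /\
    idspan [:: f] (z ^+ (m.+2 * (Na + Nb + Nc)) * c i - q).
  have [F hF] := fin_all_exists (fun i => clear_w (c i)).
  exists (\sum_i F i)%N => i; apply: (hF i).
  by rewrite (bigD1 i) //=; lia.
move: hNc (hNa _ (leq_trans (leq_addr Nb _) (leq_addr Nc _)))
  (hNb _ (leq_trans (leq_addl Na _) (leq_addr Nc _))).
move: (_ * _)%N => {Na hNa Nb hNb Nc} N hc [a' [wa ha]] [b' [wb hb']].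
have [c' hc'] := fin_all_exists hc.
(* Scaling the fraction by [z ^+ N] multiplies [c i] by [z ^+ (N * (e - i))]; one of these factors
   [z ^+ N] is spent on replacing [c i] by its representative [c' i]. *)
pose c2 (i : 'I_e) := z ^+ (N * (e - i).-1) * c' i.
have h0 : homog_eqn c2 (z ^+ N * a') b' = 0.
  apply: wfree_multiple.
    rewrite /homog_eqn; apply: wfreeD.
      by apply: wfreeXn; apply: wfreeM => //; apply: wfree_z.
    apply: (big_ind wfree wfree0 wfreeD) => i _.
    apply: wfreeM; last exact: wfreeXn.
    apply: wfreeM; first by apply: wfreeM; [apply: wfree_z|case: (hc' i)].
    by apply: wfreeXn; apply: wfreeM => //; apply: wfree_z.
  rewrite -[homog_eqn _ _ _](subKr (homog_eqn c2 (z ^+ N * (z ^+ N * a)) (z ^+ N * b))).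
  apply: idspanB; last first.
    by apply: homog_eqn_cong hb' => //; rewrite -mulrBr; apply: idspanM.
  suff h : idspan [:: f] (homog_eqn c2 (z ^+ N * (z ^+ N * a)) (z ^+ N * b)
      - z ^+ (N * e) * homog_eqn c (z ^+ N * a) (z ^+ N * b)).
    rewrite -[homog_eqn _ _ _](subrK (z ^+ (N * e) * homog_eqn c (z ^+ N * a) (z ^+ N * b))).
    by apply: idspanD => //; rewrite homog_eqn_scale; apply/idspanM/idspanM.
  rewrite /homog_eqn mulrDr opprD addrACA exprMn -exprM subrr add0r.
  rewrite mulr_sumr -sumrB; apply: (big_ind _ (idspan0 _) (@idspanD _ _)) => i _.
  set A := z ^+ N * a; set B := z ^+ N * b.
  have -> : c2 i * (z ^+ N * A) ^+ i * B ^+ (e - i)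
      - z ^+ (N * e) * (c i * A ^+ i * B ^+ (e - i))
    = - (z ^+ (N * (e - i).-1) * z ^+ (N * i) * A ^+ i * B ^+ (e - i))
      * (z ^+ N * c i - c' i).
    have -> : z ^+ (N * e) = z ^+ (N * (e - i).-1) * z ^+ (N * i) * z ^+ N.
      rewrite -!exprD; congr (_ ^+ _); have := ltn_ord i; nia.
    by rewrite /c2 exprMn -exprM; ring.
  by apply: idspanM; case: (hc' i).
have b0 : b' != 0.
  by apply/eqP => b0; move: hb'; rewrite b0 subr0 => /cancel_z.
have [q hq] := mpoly_normal b0 h0.
exists N, q; apply: (@cancel_z _ N).
have -> : z ^+ N * (z ^+ N * a - q * b) =
   z ^+ N * (z ^+ N * a - a') - q * (z ^+ N * b - b') + (z ^+ N * a' - q * b') by ring.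
rewrite hq subrr addr0; apply: idspanB; exact: idspanM.
Qed.

Lemma idspan1P p : ideal_gen (eq f) p <-> idspan [:: f] p.
Proof.
split; last first.
  apply: idspanP; first exact: ideal_gen_ideal.
  by move=> h; rewrite inE => /eqP ->; apply: ideal_gen_mem.
apply: ideal_gen_min; first exact: idspan1_ideal.
by move=> h <-; apply: idspan_mem; rewrite inE.
Qed.

Lemma one_notin : ~ idspan [:: f] 1.
Proof. exact: (@z_notin 0). Qed.

Lemma f_prime_ideal : is_prime (ideal_gen (eq f)).
Proof.
split; first exact: ideal_gen_ideal.
  by move/idspan1P; apply: one_notin.
by move=> p q /idspan1P/f_prime[] h; [left|right]; apply/idspan1P.
Qed.

Lemma f_reduced : quotient_reduced (ideal_gen (eq f)).
Proof.
have [_ h1 hM] := f_prime_ideal.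
move=> p e; elim: e => [/h1 //|e IH].
by rewrite [p ^+ e.+1]exprS => /hM[|/IH].
Qed.

Lemma f_normal : quotient_normal_domain (ideal_gen (eq f)).
Proof.
split; first exact: f_prime_ideal.
move=> a b hb [e [c /idspan1P hab]].
have {}hb : ~ idspan [:: f] b by move/idspan1P.
suff [q hq] : exists q, idspan [:: f] (a - q * b) by exists q; apply/idspan1P.
have hI := idspan1_ideal.
have [M [q hq]] := fraction_z hb hab.
elim: M q hq => [|M IH] q hq; first by exists q; rewrite mul1r in hq.
(* The fraction [q / z] equals [z ^+ M * a / b], so it is integral with these coefficients; dividing
   [q] by [z] lowers the exponent [M.+1] by one. *)
pose c2 (i : 'I_e) := c i * z ^+ (M * (e - i)).
have h : idspan [:: f] (homog_eqn c2 q z).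
  have hbe : ~ idspan [:: f] (b ^+ e) by move/idspan1P/f_reduced/idspan1P.
  suff hbe2 : idspan [:: f] (b ^+ e * homog_eqn c2 q z).
    by case: (@f_prime (b ^+ e) (homog_eqn c2 q z) hbe2) => hh; [case: (hbe hh)|exact: hh].
  rewrite -homog_eqn_scale.
  rewrite -[homog_eqn _ _ _](subrK (homog_eqn c2 (z ^+ M.+1 * a) (b * z))).
  apply: idspanD.
    apply: homog_eqn_cong; rewrite ?subrr; [exact: hI| |exact: idspan0].
    by rewrite -opprB [b * q]mulrC; apply: idspanN.
  have -> : homog_eqn c2 (z ^+ M.+1 * a) (b * z) = z ^+ (M.+1 * e) * homog_eqn c a b.
    rewrite /homog_eqn mulrDr exprMn -exprM mulr_sumr; congr (_ + _).
    apply: eq_bigr => i _; rewrite /c2 !exprMn -!exprM.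
    have -> : z ^+ (M.+1 * e) = z ^+ (M * (e - i)) * z ^+ (M.+1 * i) * z ^+ (e - i).
      rewrite -!exprD; congr (_ ^+ _); have := ltn_ord i; nia.
    by ring.
  exact: idspanM.
have [q' hq'] := @integral_div_z _ V m f_prime _ _ _ h.
apply: (IH q'); apply: (@cancel_z _ 1).
have -> : z ^+ 1 * (z ^+ M * a - q' * b) = (z ^+ M.+1 * a - q * b) + b * (q - q' * z).
  by rewrite [z ^+ M.+1]exprS expr1; ring.
by apply: idspanD => //; apply: idspanM.
Qed.

(** * The gradient ideal and the singular point *)

Hypothesis d_neq0 : (m.+2)%:R != 0 :> k.
Local Notation del := ((m.+2)%:R%:MP : S).
Local Notation X1 := (x ^+ m.+1).
Local Notation Y1 := (y ^+ m.+1).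
Local Notation Z1 := (z ^+ m.+1).
Local Notation ga := (X1 * y).
Local Notation gb := (x * X1 + del * Y1 * z).
Local Notation gc := (y * Y1 + del * Z1 * w).
Local Notation ge := (z * Z1).
Local Notation gu := (X1 * Z1).
Local Notation J := (gradient_ideal f).
Local Notation irr := (@irrelevant_ideal 4 k).

Lemma mderiv_XnX (i u v : 'I_4) : u != v -> ('X_u ^+ m.+2 * 'X_v)^`M(i) =
  (if i == u then del * 'X_u ^+ m.+1 * 'X_v
   else if i == v then 'X_u ^+ m.+2 else 0) :> S.
Proof.
move=> uv; rewrite mderivM mderivXn mderivX1 -mul_mpolyC.
case: (eqVneq i u) => [->|_].
  have -> : 'X_u ^+ m.+2 * (u == v)%:R = 0 :> S by rewrite (negPf uv) mulr0.
  exact: addr0.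
by rewrite mul0r add0r; case: eqP => _; [apply: mulr1|apply: mulr0].
Qed.

Lemma mderiv_f i : f^`M(i) =
  (if i == ix then del * ga else if i == iy then gb else if i == iz then gc else ge).
Proof.
have aux (a b c : S) : [/\ a + 0 + 0 = a, a + b + 0 = a + b,
    0 + b + c = b + c & 0 + 0 + c = c].
  by rewrite !addr0 !add0r.
rewrite !mderivD !mderiv_XnX //.
case: (ord4P i) => -> /=.
- by case: (aux (del * X1 * y) 0 0) => -> _ _ _; rewrite mulrA.
- by case: (aux (x ^+ m.+2) (del * Y1 * z) 0) => _ -> _ _.
- by case: (aux 0 (y ^+ m.+2) (del * Z1 * w)) => _ _ -> _.
- by case: (aux 0 0 (z ^+ m.+2)) => _ _ _ ->.
Qed.

Lemma del_unit : del \is a GRing.unit.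
Proof. by rewrite rmorph_unit // unitfE. Qed.

Lemma gradientP p : gradient_ideal f p <-> idspan [:: ga; gb; gc; ge] p.
Proof.
split.
  apply: ideal_gen_min; first exact: idspan_ideal.
  move=> q [i ->]; rewrite mderiv_f; case: eqP => _.
    by apply/idspanM/idspan_mem; rewrite inE eqxx.
  by do 2?[case: eqP => _]; apply: idspan_mem; rewrite !inE eqxx ?orbT.
have hI := ideal_gen_ideal (fun q : S => exists i : 'I_4, q = f^`M(i)).
have [_ _ IM] := hI.
apply: idspanP => // q; rewrite !inE => /or4P[] /eqP ->.
- rewrite -[ga](mulKr del_unit); apply: IM; apply: ideal_gen_mem.
  by exists ix; rewrite mderiv_f.
- by apply: ideal_gen_mem; exists iy; rewrite mderiv_f.
- by apply: ideal_gen_mem; exists iz; rewrite mderiv_f.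
- by apply: ideal_gen_mem; exists iw; rewrite mderiv_f.
Qed.

Lemma X_homog i : ('X_i : S) \is 1.-homog.
Proof. by rewrite dhomogX; apply/eqP/mdeg1. Qed.

Lemma Xn_homog i e : ('X_i ^+ e : S) \is e.-homog.
Proof. by have := dhomogMn e (X_homog i); rewrite mul1n. Qed.

Lemma XnX_homog i j : ('X_i ^+ m.+2 * 'X_j : S) \is (m.+3).-homog.
Proof. by rewrite -[m.+3]addn1; apply: dhomogM (Xn_homog _ _) (X_homog _). Qed.

Lemma f_homog : f \is (m.+3).-homog.
Proof. by apply: dhomogD; [apply: dhomogD|]; apply: XnX_homog. Qed.

Lemma gabce_homog :
  [/\ ga \is (m.+2).-homog, gb \is (m.+2).-homog, gc \is (m.+2).-homog
    & ge \is (m.+2).-homog].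
Proof.
have h i j : ('X_i ^+ m.+1 * 'X_j : S) \is (m.+2).-homog.
  by rewrite -[m.+2]addn1; apply: dhomogM (Xn_homog _ _) (X_homog _).
have hd i j : (del * 'X_i ^+ m.+1 * 'X_j : S) \is (m.+2).-homog.
  by rewrite -mulrA mul_mpolyC; apply: dhomogZ.
have h2 i : ('X_i * 'X_i ^+ m.+1 : S) \is (m.+2).-homog by rewrite -exprS Xn_homog.
by split=> //; apply: dhomogD.
Qed.

Lemma gradient_homog : is_homogeneous_ideal (gradient_ideal f).
Proof.
apply: homog_ideal_gen => q [i ->]; exists m.+2.
have [ha hb hc he] := gabce_homog.
rewrite mderiv_f; case: eqP => _; first by rewrite mul_mpolyC dhomogZ.
by do 2?[case: eqP => _].
Qed.

Local Notation o := (rational_point (fun i : 'I_4 => if i == ord_max then 1 else 0 : k)).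

Lemma pointP p : o p <-> idspan [:: x; y; z] p.
Proof.
split.
  apply: ideal_gen_min; first exact: idspan_ideal.
  have h i : i != ord_max -> idspan [:: x; y; z] 'X_i.
    move=> hi; apply: idspan_mem; rewrite !inE.
    by case: (ord4P i) hi => ->; rewrite ?eqxx ?orbT // => /eqP[]; apply: val_inj.
  move=> q [i [j ->]].
  case: (eqVneq i ord_max) (eqVneq j ord_max) => [->|hi] [->|hj].
  - by rewrite subrr; apply: idspan0.
  - by rewrite scale0r sub0r scale1r; apply/idspanN/h.
  - by rewrite scale0r subr0 scale1r; apply: h.
  - by rewrite !scale0r subrr; apply: idspan0.
apply: idspanP; first exact: ideal_gen_ideal.
have h i : i != ord_max -> o 'X_i.
  move=> hi; apply: ideal_gen_mem; exists i, ord_max.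
  by rewrite eqxx (negPf hi) scale1r scale0r subr0.
by move=> q; rewrite !inE => /or3P[] /eqP ->; apply: h.
Qed.

Definition at_point p := kill ix (kill iy (kill iz p)).

Lemma at_pointM p q : at_point (p * q) = at_point p * at_point q.
Proof. by rewrite /at_point !killM. Qed.

Lemma at_pointD p q : at_point (p + q) = at_point p + at_point q.
Proof. by rewrite /at_point !killD. Qed.

Lemma at_pointX i : at_point 'X_i = if i == iw then w else 0.
Proof.
by rewrite /at_point; case: (ord4P i) => ->; rewrite !(killX, kill0) /= ?killX ?kill0 /= ?killX.
Qed.

Lemma at_pointP p : idspan [:: x; y; z] p <-> at_point p = 0.
Proof.
split.
  move=> [a [b [c /eqP]]]; rewrite -!addrA -!opprD subr_eq0 => /eqP ->.
  have h i q : i != iw -> at_point (q * 'X_i) = 0.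
    by move=> /negPf hi; rewrite at_pointM at_pointX hi mulr0.
  by rewrite !at_pointD !h // !addr0.
move=> /(@ev0_eq0_two _ V ix iy)[a [b E]].
have [c hc] := kill_decomp iz p.
by exists a, b, c; rewrite /= hc E /=; ring.
Qed.

Lemma at_pointC c : at_point c%:MP = c%:MP.
Proof. by rewrite /at_point !killC. Qed.

Lemma at_point_homog e p :
  exists c, at_point (pihomog (@mdeg 4) e p) = c *: w ^+ e.
Proof.
rewrite pihomogE; apply: (big_ind (fun q => exists c, at_point q = c *: w ^+ e)).
- by exists 0; rewrite scale0r -mpolyC0 at_pointC.
- by move=> p1 p2 [c1 E1] [c2 E2]; exists (c1 + c2); rewrite at_pointD E1 E2 scalerDl.
move=> u /eqP hu; rewrite -mul_mpolyC at_pointM at_pointC.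
have [c ->] : exists c, at_point 'X_[u] = c *: w ^+ e.
  have hX i e' : at_point ('X_i ^+ e') = at_point 'X_i ^+ e'.
    elim: e' => [|e' IH]; first by rewrite !expr0 -mpolyC1 at_pointC.
    by rewrite !exprS at_pointM IH.
  rewrite mpolyXE_id !big_ord_recl big_ord0 mulr1 !at_pointM !hX !at_pointX /=.
  rewrite !expr0n; case: (eqVneq (u ord0) 0%N) => [u0|_]; last first.
    by exists 0; rewrite scale0r mul0r.
  case: (eqVneq (u (lift ord0 ord0)) 0%N) => [u1|_]; last first.
    by exists 0; rewrite scale0r mul0r mulr0.
  case: (eqVneq (u (lift ord0 (lift ord0 ord0))) 0%N) => [u2|_]; last first.
    by exists 0; rewrite scale0r mul0r !mulr0.
  exists 1; rewrite !mul1r scale1r; congr (_ ^+ _).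
  have hu' : mdeg u = e by exact: hu.
  by rewrite -hu' mdegE !big_ord_recl big_ord0 u0 u1 u2 addn0 !add0n.
by exists (p@_u * c); rewrite mul_mpolyC scalerA.
Qed.

Lemma point_homog : is_homogeneous_ideal o.
Proof.
apply: homog_ideal_gen => q [i [j ->]]; exists 1%N; rewrite -scaleNr.
by apply: dhomogD; apply: dhomogZ; apply: X_homog.
Qed.

Lemma point_o : proj_point o.
Proof.
split; last first.
- move=> h; have /pointP/at_pointP : o w.
    by apply: h; apply: ideal_gen_mem; exists iw.
  by move/eqP; rewrite at_pointX (negPf (X_neq0 _)).
- exact: point_homog.
split; first exact: ideal_gen_ideal.
  move/pointP/at_pointP/eqP; rewrite -mpolyC1 at_pointC mpolyC1.
  by rewrite oner_eq0.
move=> p q /pointP/at_pointP/eqP; rewrite at_pointM mulf_eq0.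
by case/orP => /eqP h; [left|right]; apply/pointP/at_pointP.
Qed.

Lemma gradient_point p : gradient_ideal f p -> o p.
Proof.
move=> /gradientP h; apply/pointP; apply: idspan_sub h => q.
rewrite !inE => /or4P[] /eqP ->.
- by exists (x ^+ m * y), 0, 0; rewrite /= exprS; ring.
- by exists X1, 0, (del * Y1); rewrite /=; ring.
- by exists 0, Y1, (del * z ^+ m * w); rewrite /= [Z1]exprS; ring.
- by exists 0, 0, Z1; rewrite /=; ring.
Qed.

Lemma f_point : o f.
Proof.
by apply/pointP; exists (x ^+ m.+1 * y), (y ^+ m.+1 * z), (z ^+ m.+1 * w); rewrite /= !(exprS _ m.+1); ring.
Qed.

(** A prime containing the partials contains [z], then [y], then [x], read off from [ge], [gc],
    [gb]. It cannot contain [w], being a point of Proj. *)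
Lemma sing_locus_point P : sing_locus f P <-> (forall p, P p <-> o p).
Proof.
split; last first.
  move=> h; have -> : P = o by apply/funext => p; apply/propext.
  split; first exact: point_o.
  by move=> p [->|]; [apply: f_point|apply: gradient_point].
move=> [[[[P0 PD PM] P1 Pprime] [_ Phomog] Pirr] hP].
have PX p e : P (p ^+ e) -> P p.
  by elim: e => [/P1 //|e IH]; rewrite [p ^+ e.+1]exprS => /Pprime[|/IH].
have PB p q : P (p + q) -> P q -> P p.
  by move=> h1 h2; rewrite -[p](addrK q) -mulN1r; apply: PD => //; apply: PM.
have hJ q : q \in [:: ga; gb; gc; ge] -> P q.
  by move=> hq; apply: hP; right; apply/gradientP; apply: idspan_mem.
have Pz : P z.
  by apply: (PX _ m.+2); rewrite [z ^+ m.+2]exprS; apply: hJ; rewrite !inE eqxx !orbT.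
have Py : P y.
  apply: (PX _ m.+2); rewrite [y ^+ m.+2]exprS.
  apply: (PB _ (del * Z1 * w)); first by apply: hJ; rewrite !inE eqxx !orbT.
  by rewrite [Z1]exprSr mulrA mulrAC; apply: (PM).
have Px : P x.
  apply: (PX _ m.+2); rewrite [x ^+ m.+2]exprS.
  apply: (PB _ (del * Y1 * z)); first by apply: hJ; rewrite !inE eqxx !orbT.
  exact: (PM).
have PI : is_ideal P by [].
have oP p : idspan [:: x; y; z] p -> P p.
  by apply: idspanP => // q; rewrite !inE => /or3P[] /eqP ->.
have Pw : ~ P w.
  move=> hw; apply: Pirr; apply: ideal_gen_min => // q [i ->].
  by case: (ord4P i) => ->.
have decomp p : idspan [:: x; y; z] (p - at_point p).
  apply/at_pointP; rewrite at_pointD /at_point killN killN killN.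
  have K i j q : kill i (kill j q) = kill j (kill i q).
    elim/(@mpoly_gen_ind 4 k): q => [c|u|q r hq hr|q r hq hr].
    - by rewrite !killC.
    - rewrite (killX j u) (killX i u).
      by case hj: (j == u); case hi: (i == u); rewrite ?kill0 ?killX ?hi ?hj ?kill0.
    - by rewrite !killD hq hr.
    - by rewrite !killM hq hr.
  by rewrite (K iz ix) (K iz iy) killK (K iy ix) killK killK subrr.
move=> p; split=> [hp|/pointP/oP //]; apply/pointP/at_pointP.
(* At the point each homogeneous component becomes a scalar times a power of [w]; a nonzero scalar
   would put [w] into [P]. *)
have h e : at_point (pihomog (@mdeg 4) e p) = 0.
  have [c hc] := at_point_homog e p.
  case: (eqVneq c 0) => [c0|c0]; first by rewrite hc c0 scale0r.
  case: Pw; apply: (PX _ e).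
  have : P (at_point (pihomog (@mdeg 4) e p)).
    rewrite -[at_point _](subKr (pihomog (@mdeg 4) e p)) -mulN1r.
    apply: (PD); first exact: Phomog.
    by apply: (PM); apply: oP; apply: decomp.
  rewrite hc => h; rewrite -[w ^+ e]scale1r -(mulVf c0) -scalerA -mul_mpolyC.
  exact: (PM).
rewrite (pihomog_partitionE (leqnn (msize p))).
apply: (big_ind (fun q => at_point q = 0)).
- by rewrite -mpolyC0 at_pointC.
- by move=> p1 p2 E1 E2; rewrite at_pointD E1 E2 addr0.
by move=> i _; apply: h.
Qed.

Lemma isolated_point : isolated_singularity f o.
Proof.
split; first exact/sing_locus_point.
(* The neighbourhood is all of Proj, since the singular locus is a single point. *)
exists 0%N, 1; split; first exact: dhomog1.
  by have [[_ h _] _ _] := point_o.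
by move=> Q /sing_locus_point.
Qed.

Lemma f_irreducible : proj_irreducible (ideal_gen (eq f)).
Proof.
have hI : proj_zeros (ideal_gen (eq f)) (ideal_gen (eq f)).
  split=> //; split; first exact: f_prime_ideal.
    by apply: homog_ideal_gen => q <-; exists m.+3; apply: f_homog.
  move=> h; have /idspan1P : ideal_gen (eq f) z.
    by apply: h; apply: ideal_gen_mem; exists iz.
  by rewrite -[z]expr1; apply: z_notin.
split; first by exists (ideal_gen (eq f)).
move=> I1 I2 _ _ h.
by case: (h _ hI) => -[_ h1]; [left|right] => P [hP h2]; split=> // p /h1/h2.
Qed.

(** * Linear type, saturation and socle of [J] *)

Let de i : ev0 V i del = del := killC i _.

Lemma gradient_linear_type : linear_type J.
Proof.
apply: (linear_type_of_d_sequence (gs := [:: ga; gb; gc; ge])); first exact: gradientP.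
move=> i p; exact: (@d_sequence_abce _ V m del del_unit de).
Qed.

Let JI : is_ideal J := ideal_gen_ideal _.

Let J_sub_sat p : idspan [:: ga; gb; gc; ge] p -> idspan [:: ga; gb; gc; ge; gu] p.
Proof.
apply: idspan_sub => g hg; apply: idspan_mem; move: hg; rewrite !inE.
by case/or4P => /eqP ->; rewrite eqxx ?orbT.
Qed.

Let sat_decomp p : idspan [:: ga; gb; gc; ge; gu] p -> exists t, J (p - t * gu).
Proof.
move=> /(idspan_cat [:: ga; gb; gc; ge] [:: gu])[q [hq [t ht]]].
exists t; apply/gradientP.
suff -> : p - t * gu = q by [].
by apply/eqP; rewrite -subr_eq0 addrAC; apply/eqP.
Qed.

Lemma irr_ideal : is_ideal irr. Proof. exact: ideal_gen_ideal. Qed.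

Lemma irrX i : irr 'X_i. Proof. by apply: ideal_gen_mem; exists i. Qed.

Lemma irr_mcoeff0 p : p@_0%MM = 0 -> irr p.
Proof.
have [I0 ID IM] := irr_ideal.
move=> h; rewrite [p]mpolyE big_seq; apply: (big_ind _ I0 ID) => u hu.
have u0 : u != 0%MM.
  by apply: contraTneq hu => ->; rewrite mcoeff_msupp h eqxx.
have [i hi] : exists i, u i != 0%N.
  apply/existsP; apply: contraR u0 => /existsPn h0.
  apply/eqP/mnmP => i; rewrite mnm0E; apply/eqP; rewrite -[_ == _]negbK; exact: h0.
rewrite -mul_mpolyC; apply: (IM).
have -> : 'X_[u] = 'X_[u - U_(i)] * 'X_i :> S by rewrite -mpolyXD submK // lep1mP.
by apply: (IM); apply: irrX.
Qed.

(** Multiplication by [w] alone brings a socle element into the larger ideal, modulo which [w] is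
    regular. *)
Lemma socleP p : socle J p <-> idspan [:: ga; gb; gc; ge; gu] p.
Proof.
have [J0 JD JM] := JI; split.
  move=> h; apply: (@nzd_w_sat _ V m del de); apply: J_sub_sat; apply/gradientP.
  by rewrite (mulrC _ p); apply: h; apply: irrX.
move=> /sat_decomp[t ht] q hq.
have [I0 ID IM] := irr_ideal.
have -> : p * q = q * (p - t * gu) + t * (gu * q) by ring.
apply: (JD); apply: (JM) => //.
apply: (ideal_gen_min (I := fun q => J (gu * q))) hq.
  exact: ideal_preim_mul.
by move=> _ [i ->]; apply/gradientP; apply: (@socle_gu _ V m del del_unit i).
Qed.

Lemma ideal_expP e : ideal_exp irr e (w ^+ e).
Proof.
elim: e => [//|e IH]; rewrite exprS; apply: ideal_gen_mem.
by exists w, (w ^+ e); split=> //; apply: irrX.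
Qed.

Lemma saturationP p : saturation J irr p <-> idspan [:: ga; gb; gc; ge; gu] p.
Proof.
have [J0 JD JM] := JI; split.
  move=> [e /(_ _ (ideal_expP e))] /gradientP /J_sub_sat; rewrite (mulrC p).
  exact: (nzd_mod_exp (@nzd_w_sat _ V m del de)).
move=> /socleP h; exists 1%N => q hq; apply: h.
have [I0 ID IM] := irr_ideal.
apply: ideal_gen_min hq => //.
by move=> _ [a [b [ha _ ->]]]; rewrite (mulrC a); apply: (IM).
Qed.

Lemma sat_idealP p :
  ideal_gen (fun q => J q \/ q = gu) p <-> idspan [:: ga; gb; gc; ge; gu] p.
Proof.
have hI := ideal_gen_ideal (fun q => J q \/ q = gu).
split.
  apply: ideal_gen_min; first exact: idspan_ideal.
  move=> q [/gradientP /J_sub_sat //|->].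
  by apply: idspan_mem; rewrite !inE eqxx !orbT.
move=> /sat_decomp[t ht]; rewrite -[p](subrK (t * gu)).
case: hI => _ ID IM; apply: (ID); first by apply: ideal_gen_mem; left.
by apply: (IM); apply: ideal_gen_mem; right.
Qed.

(** * Degrees in the minimal resolution *)

Lemma homogzN e p : homogz e p -> homogz e (- p).
Proof. by move=> h u; rewrite (perm_mem (msuppN p)) => /h. Qed.

Lemma homogzM e e' p q : homogz e p -> homogz e' q -> homogz (e + e') (p * q).
Proof.
move=> hp hq; suff -> : p * q = hcomp (e + e') (p * q) by exact: homogz_hcomp.
by rewrite (hcompM _ _ hq) addrK hcomp_id.
Qed.

Lemma homogz_cast e e' p : homogz e p -> e = e' -> homogz e' p.
Proof. by move=> h <-. Qed.

Lemma homogzX i : homogz 1 ('X_i : S).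
Proof. exact/homogz_pos/X_homog. Qed.

Lemma homogzXn i e : homogz e%:Z ('X_i ^+ e : S).
Proof. exact/homogz_pos/Xn_homog. Qed.

Lemma homogzC c : homogz 0 (c%:MP : S).
Proof.
apply/(homogz_pos 0); rewrite -[c%:MP]mulr1 mul_mpolyC.
by apply: dhomogZ; apply: dhomog1.
Qed.

Lemma hcomp_neq e e' p : homogz e p -> e != e' -> hcomp e' p = 0.
Proof.
case: e => [e /homogz_pos hp|e /homogz_neg -> _]; last first.
  by case: e' => [e'|//] /=; rewrite raddf0.
by case: e' => [e' ne|//] /=; rewrite (pihomog_ne0 _ hp).
Qed.

Let dz : int := (m.+2)%:Z.

Lemma gu_homogz : homogz (2 * dz - 2) gu.
Proof.
apply: (homogz_cast (homogzM (@homogzXn ix m.+1) (@homogzXn iz m.+1))).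
by rewrite /dz; lia.
Qed.

Lemma gradient_socle_degree : socle_degree J (2 * dz - 2).
Proof.
have [J0 JD JM] := JI; split.
  exists gu; split; first exact: gu_homogz.
    by apply/socleP/idspan_mem; rewrite !inE eqxx !orbT.
  by move=> /gradientP; apply: (@gu_notin _ V m del de).
move=> e [p [hp /socleP/sat_decomp[t ht] nJ]].
case: (eqVneq e (2 * dz - 2)) => [->|ne] //; case: nJ.
have hgu : socle J gu by apply/socleP/idspan_mem; rewrite !inE eqxx !orbT.
(* Only the constant term of [t] matters modulo [J], because the variables multiply [gu] into [J].
   If [e] differs from the degree of [gu], comparing components of that degree puts [t0 * gu], and
   then [p], into [J]. *)
pose t0 := (t@_0%MM)%:MP : S.
have h0 : J (p - t0 * gu).
  have -> : p - t0 * gu = (p - t * gu) + gu * (t - t0) by ring.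
  apply: (JD) => //; apply: hgu; apply: irr_mcoeff0.
  by rewrite mcoeffB /t0 mcoeffC eqxx mulr1 subrr.
suff h1 : J (- (t0 * gu)).
  have -> : p = (p - t0 * gu) + (-1) * (- (t0 * gu)) by ring.
  by apply: (JD) => //; apply: (JM).
have hz : homogz (2 * dz - 2) (t0 * gu).
  by rewrite -[2 * dz - 2]add0r; exact: (homogzM (@homogzC _) gu_homogz).
have -> : - (t0 * gu) = hcomp (2 * dz - 2) (p - t0 * gu).
  by rewrite hcompB (hcomp_neq hp ne) (hcomp_id hz) sub0r.
case: (2 * dz - 2) => [i|i] /=; last exact: J0.
exact: gradient_homog.2.
Qed.

Definition res_rk (i : nat) : nat :=
  match i with 0 => 1 | 1 => 4 | 2 => 7 | 3 => 5 | 4 => 1 | _ => 0 end.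

(** In homological degree 3, [3 * dz - 1] belongs to the second Hilbert-Burch row, whose entries
    have degree one less than [dz]; the other four rows have degree [2 * dz + 1]. *)
Definition res_deg (i : nat) : seq int :=
  match i with
  | 0 => [:: 0]
  | 1 => nseq 4 dz
  | 2 => dz + 1 :: nseq 6 (2 * dz)
  | 3 => [:: 2 * dz + 1; 3 * dz - 1; 2 * dz + 1; 2 * dz + 1; 2 * dz + 1]
  | 4 => [:: 2 * dz + 2]
  | _ => [::]
  end.

Definition res_diff (i : nat) : 'M[S]_(res_rk i.+1, res_rk i) :=
  match i with
  | 0 => res1 V m del
  | 1 => res2 V m del
  | 2 => res3 V m del
  | 3 => res4 V del
  | _ => 0
  end.

Definition res : @graded_free_complex 4 k :=
  @GradedFreeComplex 4 k res_rk (fun i a => nth 0 (res_deg i) a) res_diff 1%:M.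

Lemma gb_homogz : homogz dz gb.
Proof. by have [_ h _ _] := gabce_homog; apply/homogz_pos. Qed.
Lemma gc_homogz : homogz dz gc.
Proof. by have [_ _ h _] := gabce_homog; apply/homogz_pos. Qed.
Let del2_homogz : homogz 0 (del ^+ 2).
Proof. by rewrite expr2 -mpolyCM; apply: homogzC. Qed.

Ltac homogz_of :=
  lazymatch goal with
  | |- homogz _ (- _) => apply: homogzN; homogz_of
  | |- homogz _ (_ * _) => apply: homogzM; homogz_of
  | |- homogz _ (_ * _ + _ * _ * 'X_(@Ordinal 4 2 isT)) => exact: gb_homogz
  | |- homogz _ (_ + _) => exact: gc_homogz
  | |- homogz _ (_%:MP ^+ 2) => exact: del2_homogz
  | |- homogz _ (_%:MP) => exact: homogzC
  | |- homogz _ (_ ^+ _) => exact: homogzXn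
  | |- homogz _ _ => exact: homogzX
  end.

Ltac homogz_entry :=
  lazymatch goal with
  | |- homogz _ 0 => exact: homogz0
  | _ => apply: homogz_cast; [homogz_of | rewrite /dz; lia]
  end.

Lemma res_diff_graded i (a : 'I_(res_rk i.+1)) (b : 'I_(res_rk i)) :
  homogz (nth 0 (res_deg i.+1) a - nth 0 (res_deg i) b) (res_diff i a b).
Proof.
case: i a b => [|[|[|[|i]]]] [a ha] [b hb]; rewrite ?mxE.
- case: b hb => [|//] hb; case: a ha => [|[|[|[|a]]]] //= ha; homogz_entry.
- by case: a ha => [|[|[|[|[|[|[|a]]]]]]] //= ha;
    case: b hb => [|[|[|[|b]]]] //= hb; homogz_entry.
- by case: a ha => [|[|[|[|[|a]]]]] //= ha;
    case: b hb => [|[|[|[|[|[|[|b]]]]]]] //= hb; homogz_entry.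
- by case: a ha => [|//] ha; case: b hb => [|[|[|[|[|b]]]]] //= hb; homogz_entry.
by [].
Qed.

Lemma res_resolution : graded_free_resolution J res.
Proof.
split.
- split=> [a|i a b]; last exact: res_diff_graded.
  rewrite (ord1 a) /= mxE eqxx -mpolyC1; exact: homogzC.
- by exists 1%:M; rewrite mulmx1 mxE eqxx subrr; case: JI.
- move=> v /=; rewrite mulmx1; split.
    move=> /gradientP[a [b [c [e /eqP]]]]; rewrite subr_eq0 => /eqP E.
    exists (mx_of 1 4 [:: [:: a; b; c; e]]); apply/rowP => i.
    rewrite (ord1 i) /res1 mulrow_of // mxE /= -E; ring.
  move=> [u ->]; have [s [hs ->]] := row_mx_of u.
  apply/gradientP; rewrite /res1 mulrow_of // mxE.
  case: s hs => [|a [|b [|c [|e [|]]]]] //= _.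
  by exists a, b, c, e; ring.
move=> i; case: i => [|[|[|[|i]]]] v.
- exact: (@res1_exact _ V m del del_unit de).
- exact: (@res2_exact _ V m del de).
- exact: (@res3_exact _ V m del).
- split=> [/(@res4_inj _ V del) ->|[u ->]]; first by exists 0; rewrite mul0mx.
  by rewrite /= mulmx0 mul0mx.
have v0 (u : 'rV[S]_(rk res i.+4.+1)) : v = u by apply/matrixP => a [b hb].
by split=> [_|_]; [exists 0; apply: v0|rewrite (v0 0) mul0mx].
Qed.

Lemma res_minimal : minimal_graded_free_resolution J res.
Proof.
split; first exact: res_resolution.
move=> i a b; apply: irr_mcoeff0; apply/eqP; apply/negPn/negP => h.
have := homogz_mcoeff0 (@res_diff_graded i a b) h; move: h.
case: i a b => [|[|[|[|i]]]] [a ha] [b hb] //=.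
- by case: b hb => [|//] hb; case: a ha => [|[|[|[|a]]]] //= ha; rewrite /dz; lia.
- by case: a ha => [|[|[|[|[|[|[|a]]]]]]] //= ha;
    case: b hb => [|[|[|[|b]]]] //= hb; rewrite /dz; lia.
- by case: a ha => [|[|[|[|[|a]]]]] //= ha;
    case: b hb => [|[|[|[|[|[|[|b]]]]]]] //= hb; rewrite /dz; lia.
(* For [dz = 3] the degrees [2 * dz + 2] and [3 * dz - 1] coincide, so degrees alone do not exclude
   a unit; the corresponding entry of [res4] is 0. *)
case: a ha => [|//] ha; case: b hb => [|[|[|[|[|b]]]]] //= hb; rewrite /dz ?mxE /=; try lia.
by rewrite mcoeff0 eqxx.
Qed.

Let J_homog : is_homogeneous_ideal J := gradient_homog.

Lemma res_generator i j : generator_in_degree res i j <-> j \in res_deg i.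
Proof.
have hs : size (res_deg i) = res_rk i by case: i => [|[|[|[|[|i]]]]].
split=> [[a <-]|/(nthP 0)[a ha <-]]; first by apply: mem_nth; rewrite hs.
by rewrite hs in ha; exists (Ordinal ha).
Qed.

Lemma minimal_generatorP F i j : minimal_graded_free_resolution J F ->
  generator_in_degree F i j <-> j \in res_deg i.
Proof.
move=> hF; split=> [h|/res_generator h].
  by apply/res_generator; apply: (minimal_generator J_homog hF res_resolution h).
exact: (minimal_generator J_homog res_minimal hF.1 h).
Qed.

Lemma minimal_last F : minimal_graded_free_resolution J F ->
  last_free_module F 4 /\ is_greatest (generator_in_degree F 4) (2 * dz + 2).
Proof.
move=> hF; have gen i j := @minimal_generatorP F i j hF.
have h4 : generator_in_degree F 4 (2 * dz + 2) by apply/gen; rewrite inE.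
split; last first.
  by split=> // e /gen; rewrite inE => /eqP ->.
split; first by case: h4 => -[a ha] _ E; move: ha; rewrite E.
move=> i hi; have hd : res_deg i = [::] by case: i hi => [|[|[|[|[|i]]]]].
apply/eqP; rewrite -leqn0 leqNgt; apply/negP => hr.
have /gen : generator_in_degree F i (gdeg (Ordinal hr)) by exists (Ordinal hr).
by rewrite hd.
Qed.

(** The maxima of the degree lists: [dz >= 2] gives [dz + 1 <= 2 * dz] in step 2 and
    [2 * dz + 1 <= 3 * dz - 1] in step 3. *)
Definition res_upper (i : nat) : int := nth 0 [:: 0; dz; 2 * dz; 3 * dz - 1; 2 * dz + 2] i.

Lemma res_upper_degrees : upper_degree_sequence J res_upper.
Proof.
move=> i hi; have tor j := tor_minimal J_homog i j res_minimal.
split=> [|e]; rewrite tor res_generator.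
  by case: i hi {tor} => [|[|[|[|[|]]]]] //= _; rewrite !inE eqxx ?orbT.
case: i hi {tor} => [|[|[|[|[|]]]]] //= _; rewrite !inE /res_upper /dz /=; lia.
Qed.

End Surface.

Theorem proposition4p3 (d : nat) (k : fieldType)
  (hd : (2 <= d)%N)
  (hchar : forall p, p \in [pchar k] -> ~~ (p %| d)%N /\ ~~ (p %| d.+1)%N) :
  let x : {mpoly k[4]} := 'X_(@Ordinal 4 0 isT) in
  let y : {mpoly k[4]} := 'X_(@Ordinal 4 1 isT) in
  let z : {mpoly k[4]} := 'X_(@Ordinal 4 2 isT) in
  let w : {mpoly k[4]} := 'X_(@Ordinal 4 3 isT) in
  let f := x ^+ d * y + y ^+ d * z + z ^+ d * w in
  let J := gradient_ideal f in
  let Jsat := saturation J irrelevant_ideal in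
  let o := rational_point (fun i : 'I_4 => if i == ord_max then 1 else 0 : k) in
  [/\ [/\ isolated_singularity f o,
          (forall P, sing_locus f P <-> (forall p, P p <-> o p)),
          quotient_reduced (ideal_gen (eq f)),
          proj_irreducible (ideal_gen (eq f))
        & quotient_normal_domain (ideal_gen (eq f))],
      linear_type J,
      [/\ (forall p, Jsat p <->
             ideal_gen (fun q => J q \/ q = x ^+ d.-1 * z ^+ d.-1) p),
          (forall p, socle J p <-> Jsat p),
          socle_degree J (2 * d%:Z - 2),
          (exists F, minimal_graded_free_resolution J F)
        & (forall F, minimal_graded_free_resolution J F ->
             last_free_module F 4 /\
             is_greatest (generator_in_degree F 4) (2 * d%:Z + 2))]
    & (forall F, minimal_graded_free_resolution J F ->
         generator_in_degree F 3 (3 * d%:Z - 1)) /\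
      (exists D : nat -> int,
         [/\ upper_degree_sequence J D,
             ((3 <= d)%N -> D 4%N <= D 3%N)
           & ((3 < d)%N -> D 4%N < D 3%N)])].
Proof.
case: d hd hchar => [|[|m]] // _ hchar x y z w f J Jsat o.
have d_neq0 : (m.+2)%:R != 0 :> k.
  apply/negP => d0; have [p hp] := natf0_pchar (isT : (0 < m.+2)%N) d0.
  by have [] := hchar p hp; rewrite (dvdn_pcharf hp) d0.
split.
- split.
  + exact: isolated_point.
  + exact: sing_locus_point.
  + exact: f_reduced.
  + exact: f_irreducible.
  + exact: f_normal.
- exact: gradient_linear_type.
- split.
  + move=> p; exact: (iff_trans (saturationP d_neq0 p) (iff_sym (sat_idealP d_neq0 p))).
  + move=> p; exact: (iff_trans (socleP d_neq0 p) (iff_sym (saturationP d_neq0 p))).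
  + exact: gradient_socle_degree.
  + by exists (res m); apply: res_minimal.
  + exact: minimal_last.
split.
  move=> F hF; apply/(minimal_generatorP d_neq0 3 _ hF).
  by rewrite !inE eqxx orbT.
exists (res_upper m); split; first exact: res_upper_degrees.
  by rewrite /res_upper /=; lia.
by rewrite /res_upper /=; lia.
Qed.
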